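(* Let $\mathcal M=m(H,K)$ be a mean curvature function. Let $0$ be a parabolic point of a $C^r$ immersion, $r\ge6$, written in a Monge chart $(x,y)\mapsto(x,y,z(x,y))$ with $$z=\frac k2y^2+\frac a6x^3+\frac b2xy^2+\frac d2x^2y+\frac c6y^3+\frac A{24}x^4+\frac B6x^3y+\frac C4x^2y^2+\frac D6xy^3+\frac E{24}y^4+O(5),$$ $k>0$, $a^2+d^2\neq0$. Suppose $\mathcal M$ is 1-regular, case a), at $(\frac k2,0)$, with $\frac{\partial m}{\partial K}(\frac k2,0)=m_0>\frac1k$. (i) If $a\ne0$ then the $\mathcal M$-mean curvature lines are transversal to the parabolic curve, near which they have the cuspidal pattern. (ii) If $a=0$ and $\sigma=Ak-3d^2\ne0$, let $\delta=d^2(km_0-25)+8Ak$. If $\sigma>0$ the $\mathcal M$-mean curvature lines near $0$ form a folded saddle; if $\sigma<0$ they form a folded node when $\delta>0$ and a folded focus when $\delta<0$.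
   Context: For an immersed oriented surface let $I=E\,du^2+2F\,du\,dv+G\,dv^2$, $II=e\,du^2+2f\,du\,dv+g\,dv^2$ be the fundamental forms, $k_n=II/I$, $k_1\le k_2$ the principal curvatures, $\mathcal H=(k_1+k_2)/2$, $\mathcal K=k_1k_2$; the parabolic curve is $\{\mathcal K=0\}$. A mean curvature function $\mathcal M=m(H,K)$ satisfies: (1) $(m-H)^2\le H^2-K$ on $H^2\ge K\ge 0$; (2) $m$ is continuous on $H^2\ge K\ge0$ and analytic on $K>0$; (3) $m(tH,t^2K)=t\,m(H,K)$ for $t\ge 0$. On the surface $\mathcal M$ also denotes $m(\mathcal H,\mathcal K)$. It is *1-regular, case a)* if $m(H,0)=0$ and $\frac{\partial m}{\partial K}(H,0)>\frac1{2H}>0$; near the parabolic point one writes $\mathcal M(x,y)=(m_0+m_1x+m_2y+O(2))\,\mathcal K(x,y)$. $\mathcal M$-mean curvature lines are the curves in the closure of $\{\mathcal K>0\}$ with $k_n=\mathcal M$, i.e. solutions of $\mathbf F(x,y,p)=(g-\mathcal MG)p^2+2(f-\mathcal MF)p+(e-\mathcal ME)=0$, $p=dy/dx$. They lift to integral curves of the Lie–Cartan line field $(\mathbf F_p,\,p\mathbf F_p,\,-(\mathbf F_x+p\mathbf F_y))$ on the surface $\mathbf F=0$, whose projection to the $(x,y)$-plane folds along the parabolic curve. *Cuspidal pattern*: the lifted line field is regular and the lines of the two foliations arriving at each parabolic point form a cusp tangent to the minimal principal direction. *Folded saddle, node, focus*: the lifted line field, restricted to $\mathbf F=0$, has at the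 point over $0$ a hyperbolic singularity which is a saddle, node, focus, respectively. The separatrices of folded saddles and folded nodes are called parabolic separatrices. *)

(* Defs.v *)
(* Stdlib reals with Coquelicot. *)
From Stdlib Require Import Reals.
From Coquelicot Require Import Coquelicot.

Open Scope R_scope.

Definition is_O_2d (n : nat) (f : R -> R -> R) : Prop :=
  exists c : R,
    locally_2d (fun x y => Rabs (f x y) <= c * sqrt (x ^ 2 + y ^ 2) ^ n) 0 0.

(* Class C^n on a neighbourhood of the origin: [ex_diff_n] is pointwise. *)
Definition class_C (n : nat) (f : R -> R -> R) : Prop :=
  locally_2d (fun x y => ex_diff_n f n x y) 0 0.

(** * Mean curvature functions *)

Definition hk_domain (H K : R) : Prop := K <= H ^ 2 /\ 0 <= K.

(* On a neighbourhood of (a, b) in the set [D], [f] is the sum of an absolutely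
   convergent double power series, grouped by total degree. *)
Definition analytic_within (D : R -> R -> Prop) (f : R -> R -> R) (a b : R) : Prop :=
  exists (c : nat -> nat -> R) (rad : posreal),
    ex_series (fun n => sum_n (fun i => Rabs (c i (n - i)%nat) * rad ^ n) n) /\
    forall x y, D x y -> Rabs (x - a) < rad -> Rabs (y - b) < rad ->
      is_series
        (fun n => sum_n (fun i => c i (n - i)%nat * (x - a) ^ i * (y - b) ^ (n - i)) n)
        (f x y).

Record mean_curvature_function (m : R -> R -> R) : Prop := {
  mcf_bound : forall H K, hk_domain H K -> (m H K - H) ^ 2 <= H ^ 2 - K;
  mcf_continuous :
    continuous_on (fun q : R * R => hk_domain (fst q) (snd q))
                  (fun q : R * R => m (fst q) (snd q));
  mcf_analytic : forall H K, hk_domain H K -> 0 < K -> analytic_within hk_domain m H K;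
  mcf_homogeneous : forall t H K, 0 <= t -> hk_domain H K ->
    m (t * H) (t ^ 2 * K) = t * m H K
}.

(* 1-regularity, case a), at (H, 0), with dm/dK (H, 0) = m0.  The derivative is
   one-sided, since [m] carries no information for K < 0. *)
Definition one_regular_a (m : R -> R -> R) (H m0 : R) : Prop :=
  m H 0 = 0 /\
  filterlim (fun K => (m H K - m H 0) / K) (at_right 0) (locally m0) /\
  1 / (2 * H) < m0 /\ 0 < 1 / (2 * H).

(** * Geometry of the graph (x, y) |-> (x, y, z x y), with unit normal
    (- z_x, - z_y, 1) / W *)

Section Graph.
Variable z : R -> R -> R.

Definition z_x := partial_derive 1 0 z.
Definition z_y := partial_derive 0 1 z.
Definition area_W (x y : R) : R := sqrt (1 + z_x x y ^ 2 + z_y x y ^ 2).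

Definition I_E (x y : R) : R := 1 + z_x x y ^ 2.
Definition I_F (x y : R) : R := z_x x y * z_y x y.
Definition I_G (x y : R) : R := 1 + z_y x y ^ 2.
Definition II_e (x y : R) : R := partial_derive 2 0 z x y / area_W x y.
Definition II_f (x y : R) : R := partial_derive 1 1 z x y / area_W x y.
Definition II_g (x y : R) : R := partial_derive 0 2 z x y / area_W x y.

Definition first_form (x y u v : R) : R :=
  I_E x y * u ^ 2 + 2 * I_F x y * u * v + I_G x y * v ^ 2.
Definition second_form (x y u v : R) : R :=
  II_e x y * u ^ 2 + 2 * II_f x y * u * v + II_g x y * v ^ 2.
Definition normal_curvature (x y u v : R) : R :=
  second_form x y u v / first_form x y u v.

(* The principal curvatures k1 <= k2 are the roots of det (II - k I) =
   char_a k^2 - char_b k + char_c. *)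
Definition char_a (x y : R) : R := I_E x y * I_G x y - I_F x y ^ 2.
Definition char_b (x y : R) : R :=
  II_e x y * I_G x y - 2 * II_f x y * I_F x y + II_g x y * I_E x y.
Definition char_c (x y : R) : R := II_e x y * II_g x y - II_f x y ^ 2.
Definition principal_k1 (x y : R) : R :=
  (char_b x y - sqrt (char_b x y ^ 2 - 4 * char_a x y * char_c x y)) / (2 * char_a x y).
Definition principal_k2 (x y : R) : R :=
  (char_b x y + sqrt (char_b x y ^ 2 - 4 * char_a x y * char_c x y)) / (2 * char_a x y).
Definition mean_H (x y : R) : R := (principal_k1 x y + principal_k2 x y) / 2.
Definition gauss_K (x y : R) : R := principal_k1 x y * principal_k2 x y.

Definition minimal_principal_direction (x y u v : R) : Prop :=
  (u, v) <> (0, 0) /\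
  (II_e x y - principal_k1 x y * I_E x y) * u
    + (II_f x y - principal_k1 x y * I_F x y) * v = 0 /\
  (II_f x y - principal_k1 x y * I_F x y) * u
    + (II_g x y - principal_k1 x y * I_G x y) * v = 0.

Definition surface_M (m : R -> R -> R) (x y : R) : R := m (mean_H x y) (gauss_K x y).

Definition M_direction (m : R -> R -> R) (x y u v : R) : Prop :=
  (u, v) <> (0, 0) /\ normal_curvature x y u v = surface_M m x y.

(* At a parabolic point, every M-direction is transversal to {K = 0}. *)
Definition transversal_to_parabolic (m : R -> R -> R) (x y : R) : Prop :=
  forall u v, M_direction m x y u v ->
    Derive (fun s => gauss_K s y) x * u + Derive (fun s => gauss_K x s) y * v <> 0.

(* The implicit differential equation of the M-lines.  Here [M] is a function
   defined on a full neighbourhood of the parabolic point, which coincides with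
   [surface_M m] where K >= 0. *)
Definition M_equation (M : R -> R -> R) (x y p : R) : R :=
  (II_g x y - M x y * I_G x y) * p ^ 2
  + 2 * (II_f x y - M x y * I_F x y) * p
  + (II_e x y - M x y * I_E x y).

End Graph.

(** * The Lie-Cartan line field of an implicit equation F (x, y, p) = 0 *)

Section LieCartan.
Variable F : R -> R -> R -> R.

Definition F_x (x y p : R) : R := Derive (fun s => F s y p) x.
Definition F_y (x y p : R) : R := Derive (fun s => F x s p) y.
Definition F_p (x y p : R) : R := Derive (fun s => F x y s) p.

Definition eval3 (P : R * R * R) : R := F (fst (fst P)) (snd (fst P)) (snd P).

Definition lie_cartan (P : R * R * R) : R * R * R :=
  let x := fst (fst P) in let y := snd (fst P) in let p := snd P in
  (F_p x y p, p * F_p x y p, - (F_x x y p + p * F_y x y p)).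

Definition integral_curve (eps : posreal) (gam : R -> R * R * R) : Prop :=
  forall t, Rabs t < eps ->
    is_derive (K := R_AbsRing) (V := prod_NormedModule R_AbsRing
      (prod_NormedModule R_AbsRing R_NormedModule R_NormedModule) R_NormedModule)
      gam t (lie_cartan (gam t)).

(* The two foliations: [P] lies on F = 0 and carries the smaller, respectively
   the larger, of two distinct roots p of F (x, y, p) = 0. *)
Definition on_first_foliation (P : R * R * R) : Prop :=
  eval3 P = 0 /\ exists q, snd P < q /\ F (fst (fst P)) (snd (fst P)) q = 0.
Definition on_second_foliation (P : R * R * R) : Prop :=
  eval3 P = 0 /\ exists q, q < snd P /\ F (fst (fst P)) (snd (fst P)) q = 0.

(* l1, l2 are the eigenvalues, with multiplicity, of the linear part at [P] of
   the Lie-Cartan field restricted to the surface F = 0, regular at [P] : (v, w) is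
   a basis of the tangent plane ker dF(P), on which the linear part has matrix
   ((aa, bb), (cc, dd)). *)
Definition restricted_eigenvalues (P : R * R * R) (l1 l2 : C) : Prop :=
  exists (dF : R * R * R -> R) (L : R * R * R -> R * R * R),
    filterdiff eval3 (locally P) dF /\
    (exists u, dF u <> 0) /\
    filterdiff lie_cartan (locally P) L /\
    exists (v w : R * R * R) (aa bb cc dd : R),
      dF v = 0 /\ dF w = 0 /\
      (forall s t : R, plus (scal s v) (scal t w) = zero -> s = 0 /\ t = 0) /\
      L v = plus (scal aa v) (scal cc w) /\
      L w = plus (scal bb v) (scal dd w) /\
      Cplus l1 l2 = RtoC (aa + dd) /\
      Cmult l1 l2 = RtoC (aa * dd - bb * cc).

(* p0 is the only point of F = 0 over (x, y); there F = 0 is regular, folds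
   under the projection (x, y, p) |-> (x, y), and the Lie-Cartan field has a
   hyperbolic singularity with eigenvalues l1, l2. *)
Definition folded_hyperbolic (x y : R) (l1 l2 : C) : Prop :=
  exists p0 : R,
    (forall p, F x y p = 0 <-> p = p0) /\
    F_p x y p0 = 0 /\ Derive_n (fun p => F x y p) 2 p0 <> 0 /\
    lie_cartan (x, y, p0) = (0, 0, 0) /\
    restricted_eigenvalues (x, y, p0) l1 l2 /\
    Re l1 <> 0 /\ Re l2 <> 0.

Definition folded_saddle (x y : R) : Prop :=
  exists l1 l2 : C, folded_hyperbolic x y l1 l2 /\
    Im l1 = 0 /\ Im l2 = 0 /\ Re l1 * Re l2 < 0.

(* The eigenvalues of a node are distinct, so that it has a strong separatrix. *)
Definition folded_node (x y : R) : Prop :=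
  exists l1 l2 : C, folded_hyperbolic x y l1 l2 /\
    Im l1 = 0 /\ Im l2 = 0 /\ 0 < Re l1 * Re l2 /\ l1 <> l2.

Definition folded_focus (x y : R) : Prop :=
  exists l1 l2 : C, folded_hyperbolic x y l1 l2 /\ Im l1 <> 0 /\ Im l2 <> 0.

End LieCartan.

(** * Cuspidal pattern *)

(* t |-> (al t, be t) has at t = 0 an ordinary (semicubical) cusp with tangent
   line spanned by (u, v). *)
Definition cusp_tangent_to (al be : R -> R) (u v : R) : Prop :=
  (forall n, (n <= 3)%nat ->
     locally 0 (fun t => ex_derive_n al n t /\ ex_derive_n be n t)) /\
  Derive al 0 = 0 /\ Derive be 0 = 0 /\
  (exists c, c <> 0 /\ Derive_n al 2 0 = c * u /\ Derive_n be 2 0 = c * v) /\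
  Derive_n al 2 0 * Derive_n be 3 0 - Derive_n be 2 0 * Derive_n al 3 0 <> 0.

(* Integral curves of the Lie-Cartan field pass through the lift of the
   parabolic point (x, y); the two halves of each of them project to M-lines in {K > 0},
   one of each foliation, which together form a cusp at (x, y). *)
Definition cuspidal_at (m z M : R -> R -> R) (x y : R) : Prop :=
  let F := M_equation z M in
  exists p0 : R,
    (forall p, F x y p = 0 <-> p = p0) /\
    minimal_principal_direction z x y 1 p0 /\
    (exists eps gam, integral_curve F eps gam /\ gam 0 = (x, y, p0)) /\
    (forall eps gam, integral_curve F eps gam -> gam 0 = (x, y, p0) ->
       let al := fun t => fst (fst (gam t)) in
       let be := fun t => snd (fst (gam t)) in
       locally' 0 (fun t =>
         0 < gauss_K z (al t) (be t) /\
         M_direction z m (al t) (be t) (Derive al t) (Derive be t)) /\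
       ((at_left 0 (fun t => on_first_foliation F (gam t)) /\
         at_right 0 (fun t => on_second_foliation F (gam t))) \/
        (at_left 0 (fun t => on_second_foliation F (gam t)) /\
         at_right 0 (fun t => on_first_foliation F (gam t)))) /\
       cusp_tangent_to al be 1 p0).

Definition cuspidal_pattern_near_0 (m z M : R -> R -> R) : Prop :=
  locally_2d (fun x y => forall p, M_equation z M x y p = 0 ->
     lie_cartan (M_equation z M) (x, y, p) <> (0, 0, 0)) 0 0 /\
  locally_2d (fun x y => gauss_K z x y = 0 -> cuspidal_at m z M x y) 0 0.

(* Main.v *)
(* Write the equation as F = (g - M G) p^2 + 2 (f - M F) p + (e - M E), with M = mu K and
   K = (z_xx z_yy - z_xy^2) / (1 + z_x^2 + z_y^2)^2, so that the coefficients are of class C^2.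
   At a parabolic point M vanishes and the second form is a multiple of a square, so the only
   root p0 is the minimal principal direction, and F_p = 0 there.

   (i) At the origin F_x + p F_y = a (1 - m0 k) and K_x + p K_y = a k have opposite signs, hence
   also at p0 over every nearby parabolic point.  Along an integral curve (x, y, p) of the
   Lie-Cartan field x' = F_p, y' = p x' and p' = - (F_x + p F_y), so at the parabolic point
   x' = y' = 0, x'' = F_pp p' and x'' y''' - y'' x''' = 2 p' x''^2 <> 0 : this is a semicubical
   cusp.  The first derivative of K along the curve vanishes and the second one is
   - F_pp (F_x + p F_y) (K_x + p K_y) > 0, so both branches lie in K > 0; they belong to different
   foliations because F_p changes sign.

   (ii) If a = 0, the linear part of the field on ker dF, spanned by the x and p directions, has
   trace d (m0 k - 1), determinant - 2 (m0 k - 1) sigma and discriminant (m0 k - 1) delta. *)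
Require Import Defs.
From Stdlib Require Import Reals Lra Lia List.
From Coquelicot Require Import Coquelicot.
Import ListNotations.
Open Scope R_scope.

(** * Picard iteration in a complete normed module *)


(** [M_equation] is built from a function [M] on a full neighbourhood, whereas [m] governs it only
    where K >= 0. Proving K > 0 along the lifted curve is what turns an integral curve into a pair
    of M-lines. The cuspidal pattern also asserts that such a curve exists, hence the Picard
    theorem: with [mu] of class C^2 the field is C^1, so locally Lipschitz, and C^1 is also just
    enough for the third derivatives in the definition of the cusp.

    In (i) the opposite signs come from z_xx: at the origin e and K have x-derivatives a and a k,
    and K is subtracted with weight m0, so m0 > 1/k lets the subtracted part win. To carry the signs
    to nearby parabolic points, p0 is extended off the parabolic curve as the zero of F_p, a
    continuous function of the base point.

    In (ii), a = 0 forces d <> 0, hence F_y = d (1 - m0 k) <> 0. This makes the surface F = 0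
    regular and, the trace being - F_y, keeps the eigenvalues of a focus off the imaginary axis. *)

Section ProdComplete.
Context {U V : CompleteSpace}.

Definition lim_prod (F : (U * V -> Prop) -> Prop) : U * V :=
  (lim (filtermap fst F), lim (filtermap snd F)).

Lemma complete_cauchy_prod (F : (U * V -> Prop) -> Prop) :
  ProperFilter F -> cauchy F -> forall eps : posreal, F (ball (lim_prod F) eps).
Proof.
intros PF CF eps.
assert (H1 : filtermap fst F (ball (lim (filtermap fst F)) eps)).
{ apply complete_cauchy.
  - now apply filtermap_proper_filter.
  - intros e; destruct (CF e) as [x Hx]; exists (fst x).
    unfold filtermap; revert Hx; apply filter_imp; intros y Hy; apply Hy. }
assert (H2 : filtermap snd F (ball (lim (filtermap snd F)) eps)).
{ apply complete_cauchy.
  - now apply filtermap_proper_filter.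
  - intros e; destruct (CF e) as [x Hx]; exists (snd x).
    unfold filtermap; revert Hx; apply filter_imp; intros y Hy; apply Hy. }
unfold filtermap in H1, H2.
generalize (filter_and _ _ H1 H2); apply filter_imp.
intros y [Hy1 Hy2]; now split.
Qed.

Lemma close_lim_prod (F1 F2 : (U * V -> Prop) -> Prop) :
  filter_le F1 F2 -> filter_le F2 F1 -> close (lim_prod F1) (lim_prod F2).
Proof.
intros H1 H2 eps; split; simpl; apply close_lim;
  intros P HP; unfold filtermap in *; auto.
Qed.

Definition prod_CompleteSpace_mixin :=
  CompleteSpace.Mixin (prod_UniformSpace U V) lim_prod complete_cauchy_prod close_lim_prod.
End ProdComplete.

(** The normed part is that of [prod_NormedModule], so derivatives of curves in this space are
    literally those of [integral_curve]. *)
Definition prod_CompleteNormedModule (K : AbsRing) (U V : CompleteNormedModule K) :=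
  CompleteNormedModule.Pack K (U * V)
    (CompleteNormedModule.Class K (U * V)
       (NormedModule.class K (prod_NormedModule K U V))
       (@prod_CompleteSpace_mixin (CompleteNormedModule.CompleteSpace K U) (CompleteNormedModule.CompleteSpace K V)))
    (U * V).

Lemma minus_plus_plus {G : AbelianGroup} (x y w : G) :
  minus (plus x y) (plus x w) = minus y w.
Proof.
change (plus (plus x y) (opp (plus x w)) = plus y (opp w)).
rewrite opp_plus, (plus_comm x y), <- plus_assoc, (plus_assoc x).
now rewrite (plus_opp_r x), plus_zero_l.
Qed.

Lemma minus_plus_self {G : AbelianGroup} (x y : G) : minus (plus x y) x = y.
Proof.
change (plus (plus x y) (opp x) = y).
now rewrite (plus_comm x y), <- plus_assoc, plus_opp_r, plus_zero_r.
Qed.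

Lemma minus_zero_eq {G : AbelianGroup} (x y : G) : minus x y = zero -> x = y.
Proof.
intros H; apply (plus_reg_r (opp y)); change (minus x y = plus y (opp y)).
now rewrite H, plus_opp_r.
Qed.

Lemma norm_minus_sym {V : NormedModule R_AbsRing} (x y : V) :
  norm (minus x y) = norm (minus y x).
Proof. now rewrite <- (norm_opp (minus x y)), opp_minus. Qed.

Lemma norm_minus_self {V : NormedModule R_AbsRing} (x : V) : norm (minus x x) = 0.
Proof. rewrite minus_eq_zero; exact (norm_zero (V := V)). Qed.

Lemma norm_minus_triangle {V : NormedModule R_AbsRing} (x y w : V) :
  norm (minus x w) <= norm (minus x y) + norm (minus y w).
Proof. rewrite (minus_trans y x w); apply (norm_triangle (minus x y)). Qed.

Lemma norm_minus_triangle_le {V : NormedModule R_AbsRing} (x y w : V) (a b : R) :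
  norm (minus x y) <= a -> norm (minus y w) <= b -> norm (minus x w) <= a + b.
Proof.
intros Ha Hb; apply Rle_trans with (1 := norm_minus_triangle x y w).
now apply Rplus_le_compat.
Qed.

(** * The fixed point of the Picard operator of a globally Lipschitz field *)

Section Picard.
Context {V : CompleteNormedModule R_AbsRing}.

Variables (f : V -> V) (L : R) (X0 : V).
Hypothesis HL : 0 < L.
Hypothesis f_lip : forall x y, norm (minus (f x) (f y)) <= L * norm (minus x y).

Lemma lip_continuous (x : V) : continuous f x.
Proof.
apply filterlim_locally; intros eps.
(* A ball of radius r only bounds the norm by [norm_factor] * r, which explains the radius. *)
assert (He : 0 < eps / (L * (@norm_factor _ V))).
{ apply Rdiv_lt_0_compat; [apply eps | apply Rmult_lt_0_compat; auto; apply norm_factor_gt_0]. }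
exists (mkposreal _ He); intros y Hy.
apply (norm_compat1 (V := CompleteNormedModule.NormedModule _ V)).
apply Rle_lt_trans with (1 := f_lip y x).
generalize (norm_compat2 (V := CompleteNormedModule.NormedModule _ V) _ _ _ Hy); simpl; intros H.
replace (pos eps) with (L * (@norm_factor _ V * (eps / (L * @norm_factor _ V)))).
- now apply Rmult_lt_compat_l.
- field; split; [apply Rgt_not_eq, norm_factor_gt_0 | lra].
Qed.

(** Over a time T the integral multiplies distances by at most L * T = 1/2, the contraction factor
    of the iteration. *)
Let T := / (2 * L).

Lemma picard_time_pos : 0 < T.
Proof. unfold T; apply Rinv_0_lt_compat; lra. Qed.

(* Clamping time makes every estimate uniform on the whole line. *)
Definition clamp_time (t : R) : R := Rmax (- T) (Rmin t T).

Lemma clamp_time_bound t : Rabs (clamp_time t) <= T.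
Proof.
generalize picard_time_pos; intros; unfold clamp_time; apply Rabs_le; split.
apply Rmax_l. apply Rmax_lub; [lra | apply Rmin_r].
Qed.

Lemma clamp_time_id t : Rabs t < T -> clamp_time t = t.
Proof.
intros H; apply Rabs_def2 in H; unfold clamp_time.
rewrite Rmin_left, Rmax_right; lra.
Qed.

Lemma clamp_time_continuous t : continuous clamp_time t.
Proof.
apply filterlim_locally; intros eps; exists eps; intros y Hy.
change (Rabs (y - t) < eps) in Hy. change (Rabs (clamp_time y - clamp_time t) < eps).
apply Rle_lt_trans with (2 := Hy).
generalize picard_time_pos; intros.
unfold clamp_time, Rmax, Rmin; repeat destruct Rle_dec; unfold Rabs; repeat destruct Rcase_abs; lra.
Qed.

Definition picard_op (g : R -> V) (t : R) : V :=
  plus X0 (RInt (fun s => f (g s)) 0 (clamp_time t)).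

Section Op.
Variable g : R -> V.
Hypothesis Hg : forall t, continuous g t.

Lemma f_comp_continuous t : continuous (fun s => f (g s)) t.
Proof. apply continuous_comp; [apply Hg | apply lip_continuous]. Qed.

Lemma f_comp_is_RInt a b : is_RInt (fun s => f (g s)) a b (RInt (fun s => f (g s)) a b).
Proof. apply RInt_correct, ex_RInt_continuous; intros; apply f_comp_continuous. Qed.

Lemma picard_op_continuous t : continuous (picard_op g) t.
Proof.
unfold picard_op.
apply (continuous_plus (V := V) (fun _ => X0)); [apply continuous_const|].
apply (continuous_comp clamp_time (fun u => RInt (fun s => f (g s)) 0 u)).
- apply clamp_time_continuous.
- apply (continuous_RInt_1 (fun s => f (g s)) 0).
  exists (mkposreal 1 Rlt_0_1); intros; apply f_comp_is_RInt.
Qed.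

Lemma picard_op_derive t : Rabs t < T -> is_derive (picard_op g) t (f (g t)).
Proof.
intros Ht.
apply (is_derive_ext_loc (fun t => plus X0 (RInt (fun s => f (g s)) 0 t))).
- assert (H : 0 < T - Rabs t) by lra.
  exists (mkposreal _ H); intros u Hu; change (Rabs (u - t) < T - Rabs t) in Hu.
  unfold picard_op; rewrite clamp_time_id; auto.
  replace u with (t + (u - t)) by ring. generalize (Rabs_triang t (u-t)); lra.
- rewrite <- (plus_zero_l (f (g t))).
  apply @is_derive_plus.
  + apply @is_derive_const.
  + apply (is_derive_RInt (fun s => f (g s)) _ 0).
    * exists (mkposreal 1 Rlt_0_1); intros; apply f_comp_is_RInt.
    * apply f_comp_continuous.
Qed.
End Op.

Lemma picard_op_contract (g h : R -> V) (C : R) :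
  (forall t, continuous g t) -> (forall t, continuous h t) ->
  (forall t, norm (minus (g t) (h t)) <= C) ->
  forall t, norm (minus (picard_op g t) (picard_op h t)) <= C / 2.
Proof.
intros Hg Hh HC t.
assert (HC0 : 0 <= C) by (apply Rle_trans with (2 := HC 0); apply norm_ge_0).
unfold picard_op.
replace (minus (plus X0 (RInt (fun s => f (g s)) 0 (clamp_time t))) (plus X0 (RInt (fun s => f (h s)) 0 (clamp_time t))))
 with (minus (RInt (fun s => f (g s)) 0 (clamp_time t)) (RInt (fun s => f (h s)) 0 (clamp_time t))).
2:{ symmetry; apply (minus_plus_plus (G := CompleteNormedModule.AbelianGroup _ V)). }
apply Rle_trans with (Rabs (clamp_time t - 0) * (L * C)).
- apply (norm_RInt_le_const_abs (fun s => minus (f (g s)) (f (h s))) 0 (clamp_time t)).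
  + intros s _. apply Rle_trans with (1 := f_lip _ _).
    apply Rmult_le_compat_l; [lra | apply HC].
  + apply @is_RInt_minus; now apply f_comp_is_RInt.
- rewrite Rminus_0_r.
  apply Rle_trans with (T * (L * C)).
  + apply Rmult_le_compat_r; [apply Rmult_le_pos; lra | apply clamp_time_bound].
  + unfold T; right; field; lra.
Qed.

Fixpoint picard_iter (n : nat) : R -> V :=
  match n with O => fun _ => X0 | S n => picard_op (picard_iter n) end.

Lemma picard_iter_continuous n t : continuous (picard_iter n) t.
Proof.
revert t; induction n; intros t; simpl.
- apply continuous_const.
- now apply picard_op_continuous.
Qed.

Let C0 := T * norm (f X0).

Lemma picard_iter_step n t :
  norm (minus (picard_iter (S n) t) (picard_iter n t)) <= C0 / 2 ^ n.
Proof.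
revert t; induction n; intros t.
- simpl pow. unfold Rdiv; rewrite Rinv_1, Rmult_1_r; simpl.
  unfold picard_op.
  replace (minus (plus X0 (RInt (fun _ => f X0) 0 (clamp_time t))) X0) with (RInt (fun _ => f X0) 0 (clamp_time t)).
  2:{ symmetry; apply (minus_plus_self (G := CompleteNormedModule.AbelianGroup _ V)). }
  apply Rle_trans with (Rabs (clamp_time t - 0) * norm (f X0)).
  + apply (norm_RInt_le_const_abs (fun _ => f X0) 0 (clamp_time t)).
    * intros; apply Rle_refl.
    * apply (f_comp_is_RInt (fun _ => X0)); intros; apply continuous_const.
  + apply Rmult_le_compat_r; [apply norm_ge_0 | rewrite Rminus_0_r; apply clamp_time_bound].
- replace (C0 / 2 ^ S n) with (C0 / 2 ^ n / 2) by (simpl; field; apply pow_nonzero; lra).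
  apply (picard_op_contract (picard_iter (S n)) (picard_iter n)); auto; apply picard_iter_continuous.
Qed.

Lemma picard_iter_cauchy n k t :
  norm (minus (picard_iter (n + k) t) (picard_iter n t)) <= 2 * C0 / 2 ^ n.
Proof.
assert (HC0 : 0 <= C0) by (apply Rmult_le_pos; [left; apply picard_time_pos | apply norm_ge_0]).
assert (Hp : forall n, 0 < / 2 ^ n) by (intros; apply Rinv_0_lt_compat, pow_lt; lra).
(* The induction on k needs the exact geometric sum; the bound 2 * C0 / 2 ^ n alone leaves no room
   for one more step. *)
apply Rle_trans with (2 * C0 / 2 ^ n - 2 * C0 / 2 ^ (n + k)).
- induction k.
  + rewrite Nat.add_0_r. right. transitivity 0; [apply @norm_minus_self | ring].
  + apply Rle_trans with (1 := norm_minus_triangle _ (picard_iter (n + k) t) _).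
    rewrite Nat.add_succ_r.
    apply Rle_trans with (1 := Rplus_le_compat _ _ _ _ (picard_iter_step (n + k) t) IHk).
    replace (2 * C0 / 2 ^ S (n + k)) with (C0 / 2 ^ (n + k)) by (simpl; field; apply pow_nonzero; lra).
    unfold Rdiv; lra.
- assert (0 <= C0 * / 2 ^ (n+k)) by (apply Rmult_le_pos; auto; left; apply Hp).
  unfold Rdiv; lra.
Qed.

Definition picard_limit (t : R) : V := lim (filtermap (fun n => picard_iter n t) eventually).

Lemma pow_half_small (c : R) (eps : R) : 0 < eps -> exists N, forall n, (N <= n)%nat -> c / 2 ^ n < eps.
Proof.
intros He.
destruct (pow_lt_1_zero (/ 2) ltac:(rewrite Rabs_pos_eq; lra) (eps / (Rabs c + 1))) as [N HN].
{ apply Rdiv_lt_0_compat; auto; generalize (Rabs_pos c); lra. }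
exists N; intros n Hn; specialize (HN n Hn).
assert (Hp : 0 < / 2 ^ n) by (intros; apply Rinv_0_lt_compat, pow_lt; lra).
rewrite pow_inv, Rabs_pos_eq in HN by lra.
generalize (Rabs_pos c) (Rle_abs c); intros Hc1 Hc2.
apply Rle_lt_trans with ((Rabs c + 1) * / 2 ^ n).
- unfold Rdiv; apply Rmult_le_compat_r; lra.
- replace eps with ((Rabs c + 1) * (eps / (Rabs c + 1))) by (field; lra).
  apply Rmult_lt_compat_l; lra.
Qed.

Lemma picard_limit_dist n t :
  norm (minus (picard_limit t) (picard_iter n t)) <= 2 * C0 / 2 ^ n.
Proof.
apply le_epsilon; intros eps Heps.
assert (HP : ProperFilter (filtermap (fun n => picard_iter n t) eventually)).
{ apply filtermap_proper_filter, eventually_filter. }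
assert (He : 0 < eps / @norm_factor _ V) by (apply Rdiv_lt_0_compat; auto; apply norm_factor_gt_0).
assert (HC : cauchy (filtermap (fun n => picard_iter n t) eventually)).
{ intros e. destruct (pow_half_small (2 * C0) e (cond_pos e)) as [N HN].
  exists (picard_iter N t), N; intros m Hm.
  apply (norm_compat1 (V := CompleteNormedModule.NormedModule _ V)). replace m with (N + (m - N))%nat by lia.
  apply Rle_lt_trans with (1 := picard_iter_cauchy _ _ _). apply HN; lia. }
destruct (complete_cauchy _ HP HC (mkposreal _ He)) as [M HM].
(* The index n + M is late enough to be close to the limit and is still comparable with the iterate
   n by the Cauchy bound. *)
specialize (HM (n + M)%nat ltac:(lia)).
apply (norm_compat2 (V := CompleteNormedModule.NormedModule _ V)) in HM. simpl in HM.
replace (@norm_factor _ V * (eps / @norm_factor _ V)) with eps in HM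
  by (field; apply Rgt_not_eq, norm_factor_gt_0).
rewrite norm_minus_sym in HM.
rewrite Rplus_comm.
apply (norm_minus_triangle_le _ (picard_iter (n + M) t)); [left; exact HM | apply picard_iter_cauchy].
Qed.

Lemma picard_limit_continuous t : continuous picard_limit t.
Proof.
apply filterlim_locally; intros eps.
destruct (pow_half_small (2 * C0) (eps / 3)) as [N HN]; [generalize (cond_pos eps); lra|].
specialize (HN N (Nat.le_refl N)).
assert (He : 0 < eps / 3 / @norm_factor _ V).
{ apply Rdiv_lt_0_compat; [generalize (cond_pos eps); lra | apply norm_factor_gt_0]. }
generalize (proj1 (filterlim_locally (F := locally t) _ _) (picard_iter_continuous N t) (mkposreal _ He)).
apply filter_imp; intros u Hu.
apply (norm_compat2 (V := CompleteNormedModule.NormedModule _ V)) in Hu; simpl in Hu.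
replace (@norm_factor _ V * (eps / 3 / @norm_factor _ V)) with (eps / 3) in Hu
  by (field; apply Rgt_not_eq, norm_factor_gt_0).
apply (norm_compat1 (V := CompleteNormedModule.NormedModule _ V)).
apply Rle_lt_trans with (2 * C0 / 2 ^ N + (eps / 3 + 2 * C0 / 2 ^ N)); [|lra].
apply (norm_minus_triangle_le _ (picard_iter N u)); [apply picard_limit_dist|].
apply (norm_minus_triangle_le _ (picard_iter N t)); [left; exact Hu|].
apply Rle_trans with (2 := picard_limit_dist N t); right; apply @norm_minus_sym.
Qed.

(** Both sides lie within a vanishing distance of the iterate S N: the left by convergence, the
    right because the operator contracts the uniform distance from the limit to the iterate N. *)
Lemma picard_limit_fixed t : picard_limit t = picard_op picard_limit t.
Proof.
assert (H : norm (minus (picard_limit t) (picard_op picard_limit t)) = 0).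
{ apply Rle_antisym; [|apply norm_ge_0].
  apply le_epsilon; intros eps He.
  destruct (pow_half_small (2 * C0) (eps / 2)) as [N HN]; [lra|].
  generalize (HN N ltac:(lia)) (HN (S N) ltac:(lia)); clear HN; intros HN HN'.
  apply Rle_trans with (2 * C0 / 2 ^ S N + 2 * C0 / 2 ^ N / 2).
  - apply (norm_minus_triangle_le _ (picard_iter (S N) t)); [apply picard_limit_dist|].
    apply (picard_op_contract (picard_iter N) picard_limit).
    + apply picard_iter_continuous.
    + apply picard_limit_continuous.
    + intros s; apply Rle_trans with (2 := picard_limit_dist N s); right; apply @norm_minus_sym.
  - assert (0 <= 2 * C0 / 2 ^ N).
    { apply Rle_trans with (2 := picard_limit_dist N t), (@norm_ge_0 _ V). }
    lra. }
apply (norm_eq_zero (V := CompleteNormedModule.NormedModule _ V)) in H.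
exact (minus_zero_eq (G := CompleteNormedModule.AbelianGroup _ V) _ _ H).
Qed.

Theorem picard : exists (eps : posreal) (gam : R -> V),
  gam 0 = X0 /\ forall t, Rabs t < eps -> is_derive gam t (f (gam t)).
Proof.
exists (mkposreal _ picard_time_pos), picard_limit; split.
- rewrite picard_limit_fixed; unfold picard_op.
  rewrite clamp_time_id, RInt_point, plus_zero_r; auto.
  rewrite Rabs_R0; apply picard_time_pos.
- intros t Ht.
  apply (is_derive_ext (picard_op picard_limit)).
  + intros; now rewrite <- picard_limit_fixed.
  + apply picard_op_derive; auto; apply picard_limit_continuous.
Qed.
End Picard.

(** * Functions of class C^n of two variables *)


Definition partials (f fx fy : R -> R -> R) (x y : R) : Prop :=
  locally_2d (fun u v => is_derive (fun t => f t v) u (fx u v) /\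
                         is_derive (fun t => f u t) v (fy u v)) x y.

(* Class C^n near (x, y), with the partial derivatives named explicitly
   instead of through the total operator [Derive]. *)
Fixpoint smooth (n : nat) (f : R -> R -> R) (x y : R) : Prop :=
  match n with
  | O => locally_2d (continuity_2d_pt f) x y
  | S n => exists fx fy, partials f fx fy x y /\ smooth n fx x y /\ smooth n fy x y
  end.

Lemma locally_2d_imp (P Q : R -> R -> Prop) x y :
  (forall u v, P u v -> Q u v) -> locally_2d P x y -> locally_2d Q x y.
Proof. intros H [e He]; exists e; auto. Qed.

Lemma locally_2d_open (P : R -> R -> Prop) x y :
  locally_2d P x y -> locally_2d (locally_2d P) x y.
Proof.
intros H; apply locally_2d_impl_strong with (2 := H).
now apply locally_2d_forall.
Qed.

Lemma partials_open f fx fy x y :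
  partials f fx fy x y -> locally_2d (partials f fx fy) x y.
Proof. intros H; now apply locally_2d_open. Qed.

Lemma smooth_open n f x y : smooth n f x y -> locally_2d (smooth n f) x y.
Proof.
revert f; induction n; intros f; simpl.
- apply locally_2d_open.
- intros (fx & fy & H & Hx & Hy).
  generalize (locally_2d_and _ _ _ _ (partials_open _ _ _ _ _ H)
    (locally_2d_and _ _ _ _ (IHn _ Hx) (IHn _ Hy))).
  apply locally_2d_imp; intros u v (H1 & H2 & H3); now exists fx, fy.
Qed.

Lemma partials_ext_loc f g fx fy x y :
  locally_2d (fun u v => f u v = g u v) x y -> partials f fx fy x y -> partials g fx fy x y.
Proof.
intros H Hf.
generalize (locally_2d_and _ _ _ _ (locally_2d_open _ _ _ H) Hf).
apply locally_2d_imp; intros u v (E & D1 & D2); split.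
- apply is_derive_ext_loc with (2 := D1).
  generalize (locally_2d_1d_const_y _ _ _ E). now apply filter_imp.
- apply is_derive_ext_loc with (2 := D2).
  generalize (locally_2d_1d_const_x _ _ _ E). now apply filter_imp.
Qed.

Lemma smooth_ext_loc n f g x y :
  locally_2d (fun u v => f u v = g u v) x y -> smooth n f x y -> smooth n g x y.
Proof.
destruct n; intros H; simpl.
- intros Hf; generalize (locally_2d_and _ _ _ _ (locally_2d_open _ _ _ H) Hf).
  apply locally_2d_imp; intros u v (E & C).
  now apply continuity_2d_pt_ext_loc with (1 := E).
- intros (fx & fy & Hf & Hx & Hy); exists fx, fy; split; auto.
  now apply partials_ext_loc with (1 := H).
Qed.

Lemma smooth_ext n f g x y :
  (forall u v, f u v = g u v) -> smooth n f x y -> smooth n g x y.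
Proof. intros H; apply smooth_ext_loc; now apply locally_2d_forall. Qed.

(** An increment splits into a step in x, controlled by the continuity of [fx], and a step in y from
    the base point, controlled by the derivative there. *)
Lemma partials_differentiable f fx fy x y :
  partials f fx fy x y -> continuity_2d_pt fx x y ->
  differentiable_pt_lim f x y (fx x y) (fy x y).
Proof.
intros H Hc; apply filterdiff_differentiable_pt_lim.
apply (is_derive_filterdiff f x y fx (fy x y)).
- apply (locally_2d_locally (fun u v => is_derive (fun t => f t v) u (fx u v))).
  revert H; apply locally_2d_imp; tauto.
- now apply locally_2d_singleton in H.
- now apply continuity_2d_pt_filterlim.
Qed.

Lemma smooth_continuous n f x y : smooth n f x y -> continuity_2d_pt f x y.
Proof.
revert f; induction n; intros f; simpl.
- apply locally_2d_singleton.
- intros (fx & fy & H & Hx & Hy).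
  apply differentiable_continuity_pt; exists (fx x y), (fy x y).
  apply partials_differentiable; auto.
Qed.

Lemma smooth_differentiable n f fx fy x y :
  partials f fx fy x y -> smooth n fx x y ->
  differentiable_pt_lim f x y (fx x y) (fy x y).
Proof. intros H Hx; apply partials_differentiable; auto. now apply smooth_continuous with n. Qed.

Lemma smooth_pred n f x y : smooth (S n) f x y -> smooth n f x y.
Proof.
revert f; induction n; intros f H.
- generalize (smooth_open _ _ _ _ H); simpl; apply locally_2d_imp.
  intros u v; apply (smooth_continuous 1).
- destruct H as (fx & fy & H & Hx & Hy).
  exists fx, fy; auto.
Qed.

Lemma smooth_le n m f x y : (m <= n)%nat -> smooth n f x y -> smooth m f x y.
Proof. induction 1; auto. intros; apply IHle; now apply smooth_pred. Qed.

Lemma smooth_const n c x y : smooth n (fun _ _ => c) x y.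
Proof.
revert c; induction n; intros c; simpl.
- apply locally_2d_forall; intros; apply continuity_2d_pt_const.
- exists (fun _ _ => 0), (fun _ _ => 0); repeat split; auto.
  apply locally_2d_forall; intros; split; apply @is_derive_const.
Qed.

Lemma smooth_fst n x y : smooth n (fun u _ => u) x y.
Proof.
destruct n; simpl.
- apply locally_2d_forall; intros; apply continuity_2d_pt_id1.
- exists (fun _ _ => 1), (fun _ _ => 0); repeat split; try apply smooth_const.
  apply locally_2d_forall; intros; split; [apply @is_derive_id | apply @is_derive_const].
Qed.

Lemma smooth_snd n x y : smooth n (fun _ v => v) x y.
Proof.
destruct n; simpl.
- apply locally_2d_forall; intros; apply continuity_2d_pt_id2.
- exists (fun _ _ => 0), (fun _ _ => 1); repeat split; try apply smooth_const.
  apply locally_2d_forall; intros; split; [apply @is_derive_const | apply @is_derive_id].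
Qed.

Lemma partials_plus f fx fy g gx gy x y :
  partials f fx fy x y -> partials g gx gy x y ->
  partials (fun u v => f u v + g u v) (fun u v => fx u v + gx u v)
    (fun u v => fy u v + gy u v) x y.
Proof.
intros Hf Hg; generalize (locally_2d_and _ _ _ _ Hf Hg).
apply locally_2d_imp; intros u v ((F1 & F2) & G1 & G2); split.
- now apply (is_derive_plus (fun t => f t v) (fun t => g t v)).
- now apply (is_derive_plus (fun t => f u t) (fun t => g u t)).
Qed.

Lemma partials_mult f fx fy g gx gy x y :
  partials f fx fy x y -> partials g gx gy x y ->
  partials (fun u v => f u v * g u v) (fun u v => fx u v * g u v + f u v * gx u v)
    (fun u v => fy u v * g u v + f u v * gy u v) x y.
Proof.
intros Hf Hg; generalize (locally_2d_and _ _ _ _ Hf Hg).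
apply locally_2d_imp; intros u v ((F1 & F2) & G1 & G2); split.
- now apply (Derive.is_derive_mult (fun t => f t v) (fun t => g t v)).
- now apply (Derive.is_derive_mult (fun t => f u t) (fun t => g u t)).
Qed.

Lemma smooth_plus n f g x y :
  smooth n f x y -> smooth n g x y -> smooth n (fun u v => f u v + g u v) x y.
Proof.
revert f g; induction n; intros f g.
- intros Hf Hg; generalize (locally_2d_and _ _ _ _ Hf Hg).
  apply locally_2d_imp; intros u v (H1 & H2); now apply continuity_2d_pt_plus.
- intros (fx & fy & Hf & Hfx & Hfy) (gx & gy & Hg & Hgx & Hgy).
  eexists; eexists; split; [apply (partials_plus _ _ _ _ _ _ _ _ Hf Hg)|].
  split; now apply IHn.
Qed.

Lemma smooth_mult n f g x y :
  smooth n f x y -> smooth n g x y -> smooth n (fun u v => f u v * g u v) x y.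
Proof.
revert f g; induction n; intros f g Sf Sg.
- generalize (locally_2d_and _ _ _ _ Sf Sg).
  apply locally_2d_imp; intros u v (H1 & H2); now apply continuity_2d_pt_mult.
- generalize (smooth_pred _ _ _ _ Sf) (smooth_pred _ _ _ _ Sg); intros Sf' Sg'.
  destruct Sf as (fx & fy & Hf & Hfx & Hfy). destruct Sg as (gx & gy & Hg & Hgx & Hgy).
  eexists; eexists; split; [apply (partials_mult _ _ _ _ _ _ _ _ Hf Hg)|].
  split; apply smooth_plus; now apply IHn.
Qed.

Lemma smooth_opp n f x y : smooth n f x y -> smooth n (fun u v => - f u v) x y.
Proof.
intros H; apply (smooth_ext n (fun u v => -1 * f u v)); [intros; ring|].
apply smooth_mult; auto; apply smooth_const.
Qed.

Lemma smooth_minus n f g x y :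
  smooth n f x y -> smooth n g x y -> smooth n (fun u v => f u v - g u v) x y.
Proof. intros; apply smooth_plus; auto; now apply smooth_opp. Qed.

Lemma smooth_pow n f k x y : smooth n f x y -> smooth n (fun u v => f u v ^ k) x y.
Proof.
intros H; induction k; simpl.
- apply smooth_const.
- now apply smooth_mult.
Qed.

Lemma continuity_2d_pt_pos f x y :
  continuity_2d_pt f x y -> 0 < f x y -> locally_2d (fun u v => 0 < f u v) x y.
Proof.
intros H Hp; destruct (H (mkposreal _ Hp)) as [e He]; exists e; intros u v Hu Hv.
specialize (He u v Hu Hv); simpl in He; apply Rabs_def2 in He; lra.
Qed.

Lemma smooth_inv n f x y :
  smooth n f x y -> f x y <> 0 -> smooth n (fun u v => / f u v) x y.
Proof.
intros Sf Hnz.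
assert (Hn : locally_2d (fun u v => f u v <> 0) x y).
{ apply continuity_2d_pt_neq_0; auto; now apply smooth_continuous with n. }
clear Hnz; induction n.
- generalize (locally_2d_and _ _ _ _ Sf Hn).
  apply locally_2d_imp; intros u v (H1 & H2); now apply continuity_2d_pt_inv.
- generalize (IHn (smooth_pred _ _ _ _ Sf)); intros Si.
  destruct Sf as (fx & fy & Hf & Hfx & Hfy).
  (* Written as polynomials in / f, the partials are of class C^n by [Si], the induction hypothesis
     for / f itself. *)
  exists (fun u v => - fx u v * (/ f u v) ^ 2), (fun u v => - fy u v * (/ f u v) ^ 2).
  split; [|split; apply smooth_mult; try (now apply smooth_opp); now apply smooth_pow].
  generalize (locally_2d_and _ _ _ _ Hf Hn).
  apply locally_2d_imp; intros u v ((H1 & H2) & H3); split.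
  + replace (- fx u v * (/ f u v) ^ 2) with (- fx u v / f u v ^ 2) by (field; auto).
    now apply (is_derive_inv (fun t => f t v)).
  + replace (- fy u v * (/ f u v) ^ 2) with (- fy u v / f u v ^ 2) by (field; auto).
    now apply (is_derive_inv (fun t => f u t)).
Qed.

Lemma smooth_div n f g x y :
  smooth n f x y -> smooth n g x y -> g x y <> 0 -> smooth n (fun u v => f u v / g u v) x y.
Proof. intros; apply smooth_mult; auto; now apply smooth_inv. Qed.

Lemma smooth_sqrt n f x y :
  smooth n f x y -> 0 < f x y -> smooth n (fun u v => sqrt (f u v)) x y.
Proof.
intros Sf Hnz.
assert (Hn : locally_2d (fun u v => 0 < f u v) x y).
{ apply continuity_2d_pt_pos; auto; now apply smooth_continuous with n. }
induction n.
- generalize (locally_2d_and _ _ _ _ Sf Hn).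
  apply locally_2d_imp; intros u v (H1 & H2).
  apply continuity_1d_2d_pt_comp; auto. apply continuity_pt_sqrt; lra.
- generalize (IHn (smooth_pred _ _ _ _ Sf)); intros Si.
  destruct Sf as (fx & fy & Hf & Hfx & Hfy).
  assert (Sd : smooth n (fun u v => / (2 * sqrt (f u v))) x y).
  { apply smooth_inv.
    - apply smooth_mult; auto; apply smooth_const.
    - generalize (sqrt_lt_R0 _ Hnz); lra. }
  exists (fun u v => fx u v * / (2 * sqrt (f u v))), (fun u v => fy u v * / (2 * sqrt (f u v))).
  split; [|split; now apply smooth_mult].
  generalize (locally_2d_and _ _ _ _ Hf Hn).
  apply locally_2d_imp; intros u v ((H1 & H2) & H3); split.
  + apply (is_derive_comp sqrt (fun t => f t v)); auto.
    apply is_derive_Reals; now apply derivable_pt_lim_sqrt.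
  + apply (is_derive_comp sqrt (fun t => f u t)); auto.
    apply is_derive_Reals; now apply derivable_pt_lim_sqrt.
Qed.

Lemma class_C_smooth n f : class_C n f -> smooth n f 0 0.
Proof.
unfold class_C; generalize 0 at 1 3; intros x; generalize 0; intros y.
revert f; induction n; intros f H.
- revert H; apply locally_2d_imp; simpl; tauto.
- exists (fun u v => Derive (fun t => f t v) u), (fun u v => Derive (fun t => f u t) v).
  repeat split.
  + revert H; apply locally_2d_imp; intros u v (_ & H1 & H2 & _); split; now apply Derive_correct.
  + apply IHn; revert H; apply locally_2d_imp; intros u v (_ & _ & _ & H1 & _); auto.
  + apply IHn; revert H; apply locally_2d_imp; intros u v (_ & _ & _ & _ & H1); auto.
Qed.

Lemma class_C_partial_derive n f p q :
  (p + q <= n)%nat -> class_C n f -> class_C (n - (p + q)) (partial_derive p q f).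
Proof. intros Hpq; apply locally_2d_imp; intros u v; now apply ex_diff_n_deriv. Qed.

(** * Jets *)


(** The coefficients start from the lowest degree, so that removing the head of the list is dividing
    by s once the constant term is known to vanish. *)
Fixpoint horner (l : list R) (s : R) : R :=
  match l with [] => 0 | c :: l => c + s * horner l s end.

Lemma horner_bounded l : exists B, 0 <= B /\ forall s, 0 < s < 1 -> Rabs (horner l s) <= B.
Proof.
induction l as [|c l (B & HB & IH)]; simpl.
- exists 0; split; [lra|]; intros; rewrite Rabs_R0; lra.
- exists (Rabs c + B); split; [generalize (Rabs_pos c); lra|].
  intros s Hs; apply Rle_trans with (1 := Rabs_triang _ _).
  apply Rplus_le_compat_l; rewrite Rabs_mult, (Rabs_pos_eq s) by lra.
  specialize (IH s Hs); generalize (Rabs_pos (horner l s)); nra.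
Qed.

Lemma horner_head_zero c l C e :
  0 < e -> (forall s, 0 < s < e -> Rabs (horner (c :: l) s) <= C * s ^ length (c :: l)) ->
  c = 0.
Proof.
intros He H.
destruct (horner_bounded l) as (B & HB & HBl).
destruct (Req_dec c 0) as [|Hc]; auto; exfalso.
assert (Hc' : 0 < Rabs c) by (now apply Rabs_pos_lt).
(* For s <= 1 all contributions besides c add up to at most s * (Rabs C + B). The + 1 makes D
   positive, and an s with s * D <= Rabs c / 2 then contradicts c <> 0. *)
set (D := Rabs C + B + 1). assert (HD : 1 <= D) by (unfold D; generalize (Rabs_pos C); lra).
assert (Hq : 0 < Rabs c / (2 * D)) by (apply Rdiv_lt_0_compat; lra).
set (s := Rmin (Rmin (e / 2) (/ 2)) (Rabs c / (2 * D))).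
assert (Hs : 0 < s) by (unfold s; repeat apply Rmin_glb_lt; lra).
assert (Hs1 : s <= e / 2) by (unfold s; eapply Rle_trans; [apply Rmin_l | apply Rmin_l]).
assert (Hs2 : s <= / 2) by (unfold s; eapply Rle_trans; [apply Rmin_l | apply Rmin_r]).
assert (Hs3 : s <= Rabs c / (2 * D)) by (unfold s; apply Rmin_r).
specialize (H s ltac:(lra)); specialize (HBl s ltac:(lra)); simpl in H.
assert (Hs4 : s * D <= Rabs c / 2).
{ replace (Rabs c / 2) with (Rabs c / (2 * D) * D) by (field; lra).
  apply Rmult_le_compat_r; lra. }
assert (Hp : 0 <= s ^ length l <= 1).
{ split; [apply pow_le; lra|]. rewrite <- (pow1 (length l)); apply pow_incr; lra. }
assert (Hb : Rabs c <= Rabs (c + s * horner l s) + Rabs (s * horner l s)).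
{ replace c with ((c + s * horner l s) - s * horner l s) at 1 by ring.
  unfold Rminus; apply Rle_trans with (1 := Rabs_triang _ _); rewrite Rabs_Ropp; lra. }
rewrite (Rabs_mult s), (Rabs_pos_eq s) in Hb by lra.
assert (C * (s * s ^ length l) <= Rabs C * s).
{ apply Rle_trans with (Rabs C * (s * s ^ length l)).
  - apply Rmult_le_compat_r; [nra | apply Rle_abs].
  - apply Rmult_le_compat_l; [apply Rabs_pos | nra]. }
unfold D in Hs4; nra.
Qed.

Lemma horner_small_zero l C e :
  0 < e -> (forall s, 0 < s < e -> Rabs (horner l s) <= C * s ^ length l) ->
  List.Forall (fun c => c = 0) l.
Proof.
intros He; revert C; induction l as [|c l IH]; intros C H; constructor.
- now apply horner_head_zero with (1 := He) (2 := H).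
- assert (Hc : c = 0) by (now apply horner_head_zero with (1 := He) (2 := H)).
  apply (IH C); intros s Hs; specialize (H s Hs); simpl in H; rewrite Hc, Rplus_0_l in H.
  rewrite Rabs_mult, (Rabs_pos_eq s) in H by lra.
  apply Rmult_le_reg_l with s; [lra|]. lra.
Qed.

(* Restricted to a line through the origin, a C^5 function and its jet differ by O(s^5),
   which identifies the homogeneous parts of degree at most 4. *)
Lemma jet4_differential (f : R -> R -> R) (P1 P2 P3 P4 : R -> R -> R) (P0 : R) :
  class_C 5 f ->
  is_O_2d 5 (fun x y => f x y - (P0 + P1 x y + P2 x y + P3 x y + P4 x y)) ->
  (forall s u v, P1 (s * u) (s * v) = s * P1 u v) ->
  (forall s u v, P2 (s * u) (s * v) = s ^ 2 * P2 u v) ->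
  (forall s u v, P3 (s * u) (s * v) = s ^ 3 * P3 u v) ->
  (forall s u v, P4 (s * u) (s * v) = s ^ 4 * P4 u v) ->
  forall u v, differential 1 f 0 0 u v = P1 u v /\ differential 2 f 0 0 u v = 2 * P2 u v /\
   differential 3 f 0 0 u v = 6 * P3 u v /\ differential 4 f 0 0 u v = 24 * P4 u v.
Proof.
intros Hf [C HC] H1 H2 H3 H4 u v.
destruct (Taylor_Lagrange_2d f 4 0 0 Hf) as [D HD].
destruct (locally_2d_and _ _ _ _ HC HD) as [e He].
(* For s < e / q the point (s u, s v) stays in the neighbourhood; the + 1 covers u = v = 0. *)
set (q := Rabs u + Rabs v + 1).
assert (Hu := Rabs_pos u). assert (Hv := Rabs_pos v).
assert (Hq : 0 < q) by (unfold q; lra).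
assert (Hs : forall s, 0 < s < e / q ->
  Rabs (horner [f 0 0 - P0; differential 1 f 0 0 u v - P1 u v;
     differential 2 f 0 0 u v / 2 - P2 u v; differential 3 f 0 0 u v / 6 - P3 u v;
     differential 4 f 0 0 u v / 24 - P4 u v] s) <=
   ((C * sqrt (u ^ 2 + v ^ 2) ^ 5 + D * Rmax (Rabs u) (Rabs v) ^ 5)) * s ^ 5).
{ intros s Hs.
  assert (Hse : s * q < e).
  { replace (pos e) with (e / q * q) by (field; lra). apply Rmult_lt_compat_r; lra. }
  assert (Hsu : Rabs (s * u - 0) = s * Rabs u) by (rewrite Rminus_0_r, Rabs_mult, Rabs_pos_eq; lra).
  assert (Hsv : Rabs (s * v - 0) = s * Rabs v) by (rewrite Rminus_0_r, Rabs_mult, Rabs_pos_eq; lra).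
  destruct (He (s * u) (s * v)) as [E1 E2].
  { rewrite Hsu; unfold q in Hse; nra. }
  { rewrite Hsv; unfold q in Hse; nra. }
  rewrite Hsu, Hsv, 2!Rminus_0_r in E2.
  rewrite H1, H2, H3, H4 in E1.
  replace (sqrt ((s * u) ^ 2 + (s * v) ^ 2)) with (s * sqrt (u ^ 2 + v ^ 2)) in E1.
  2:{ replace ((s * u) ^ 2 + (s * v) ^ 2) with (s ^ 2 * (u ^ 2 + v ^ 2)) by ring.
      rewrite sqrt_mult_alt, sqrt_pow2; [auto | lra | apply pow2_ge_0]. }
  replace (Rmax (s * Rabs u) (s * Rabs v)) with (s * Rmax (Rabs u) (Rabs v)) in E2
    by (symmetry; apply RmaxRmult; lra).
  rewrite Rpow_mult_distr in E1, E2.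
  (* The polynomial is a difference of two remainders, that of the given jet and that of the Taylor
     formula, both O(s^5). *)
  replace (horner _ s) with ((f (s * u) (s * v) - (P0 + s * P1 u v + s ^ 2 * P2 u v + s ^ 3 * P3 u v
    + s ^ 4 * P4 u v)) - (f (s * u) (s * v) - DL_pol 4 f 0 0 (s * u) (s * v))).
  - unfold Rminus at 1; apply Rle_trans with (1 := Rabs_triang _ _); rewrite Rabs_Ropp; lra.
  - assert (Hd : forall n, differential n f 0 0 (s * u) (s * v) = s ^ n * differential n f 0 0 u v).
    { intros n; unfold differential; rewrite scal_sum; apply sum_eq; intros i Hi.
      rewrite 2!Rpow_mult_distr.
      replace (s ^ n) with (s ^ i * s ^ (n - i)) by (rewrite <- pow_add; f_equal; lia).
      ring. }
    unfold DL_pol; simpl sum_f_R0; rewrite !Hd; simpl Factorial.fact.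
    replace (differential 0 f 0 0 u v) with (f 0 0)
      by (unfold differential, partial_derive, Binomial.C; simpl; field).
    simpl horner; field. }
apply horner_small_zero in Hs; [|apply Rdiv_lt_0_compat; [apply cond_pos | auto]].
inversion_clear Hs as [|? ? _ Hs1]; inversion_clear Hs1 as [|? ? G1 Hs2];
inversion_clear Hs2 as [|? ? G2 Hs3]; inversion_clear Hs3 as [|? ? G3 Hs4];
inversion_clear Hs4 as [|? ? G4 _].
repeat split; lra.
Qed.

Lemma jet4_partial_derive (z : R -> R -> R) (k a b c d A B C D E : R) :
  class_C 5 z ->
  is_O_2d 5 (fun x y => z x y -
     (k / 2 * y ^ 2 + a / 6 * x ^ 3 + b / 2 * x * y ^ 2 + d / 2 * x ^ 2 * y
      + c / 6 * y ^ 3 + A / 24 * x ^ 4 + B / 6 * x ^ 3 * y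
      + C / 4 * x ^ 2 * y ^ 2 + D / 6 * x * y ^ 3 + E / 24 * y ^ 4)) ->
  (partial_derive 1 0 z 0 0 = 0 /\ partial_derive 0 1 z 0 0 = 0) /\
  (partial_derive 2 0 z 0 0 = 0 /\ partial_derive 1 1 z 0 0 = 0 /\
   partial_derive 0 2 z 0 0 = k) /\
  (partial_derive 3 0 z 0 0 = a /\ partial_derive 2 1 z 0 0 = d) /\
  partial_derive 4 0 z 0 0 = A.
Proof.
intros Hz HO.
assert (H := jet4_differential z (fun _ _ => 0) (fun _ y => k / 2 * y ^ 2)
  (fun x y => a / 6 * x ^ 3 + b / 2 * x * y ^ 2 + d / 2 * x ^ 2 * y + c / 6 * y ^ 3)
  (fun x y => A / 24 * x ^ 4 + B / 6 * x ^ 3 * y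
      + C / 4 * x ^ 2 * y ^ 2 + D / 6 * x * y ^ 3 + E / 24 * y ^ 4) 0 Hz).
lapply H; [clear H; intros H|].
2:{ destruct HO as [C0 HO]; exists C0; revert HO; apply locally_2d_imp; intros u v.
    intros HO; eapply Rle_trans; [|exact HO]; right; f_equal; ring. }
specialize (H ltac:(intros; ring) ltac:(intros; ring) ltac:(intros; ring) ltac:(intros; ring)).
cbv beta in H.
(* The axes give the pure derivatives, (1, 1) the mixed second one, and comparing (1, 1) with (1,
   -1) separates z_xxy from z_xyy; the rest is a linear system. *)
destruct (H 1 0) as (A1 & A2 & A3 & A4).
destruct (H 0 1) as (B1 & B2 & B3 & _).
destruct (H 1 1) as (_ & C2 & C3 & _).
destruct (H 1 (-1)) as (_ & _ & D3 & _).
clear H.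
unfold differential, Binomial.C in *; simpl in *.
lra.
Qed.

(** * Local existence of integral curves in R^3 *)


(** The bracketing is the one in [integral_curve], and [R3_complete] is its complete counterpart for
    [picard]. *)
Definition R3 : NormedModule R_AbsRing :=
  prod_NormedModule R_AbsRing
    (prod_NormedModule R_AbsRing R_NormedModule R_NormedModule) R_NormedModule.

Definition R3_complete : CompleteNormedModule R_AbsRing :=
  prod_CompleteNormedModule R_AbsRing
    (prod_CompleteNormedModule R_AbsRing R_CompleteNormedModule R_CompleteNormedModule)
    R_CompleteNormedModule.

Definition dist3 (P Q : R * R * R) : R := norm (V := R3) (minus (G := R3) P Q).

Lemma norm_prod_coord {U V : NormedModule R_AbsRing} (P : U * V) :
  norm (fst P) <= norm P /\ norm (snd P) <= norm P.
Proof.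
destruct P as [u v]; destruct (norm_prod u v) as [H _]; simpl; split.
- apply Rle_trans with (2 := H), Rmax_l.
- apply Rle_trans with (2 := H), Rmax_r.
Qed.

Lemma norm_prod_le_sum {U V : NormedModule R_AbsRing} (u : U) (v : V) :
  norm ((u, v) : prod_NormedModule _ U V) <= norm u + norm v.
Proof.
change (sqrt (norm u ^ 2 + norm v ^ 2) <= norm u + norm v).
generalize (norm_ge_0 u) (norm_ge_0 v); intros Hu Hv.
rewrite <- (sqrt_pow2 (norm u + norm v)) by lra.
apply sqrt_le_1_alt; nra.
Qed.

Lemma dist3_coord (x y p x' y' p' : R) :
  Rabs (x - x') <= dist3 (x, y, p) (x', y', p') /\
  Rabs (y - y') <= dist3 (x, y, p) (x', y', p') /\
  Rabs (p - p') <= dist3 (x, y, p) (x', y', p').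
Proof.
destruct (@norm_prod_coord (prod_NormedModule R_AbsRing R_NormedModule R_NormedModule)
  R_NormedModule (minus (G := R3) (x, y, p) (x', y', p'))) as [H1 H2].
destruct (@norm_prod_coord R_NormedModule R_NormedModule
  (fst (minus (G := R3) (x, y, p) (x', y', p')))) as [H3 H4].
repeat split.
- eapply Rle_trans; [exact H3 | exact H1].
- eapply Rle_trans; [exact H4 | exact H1].
- exact H2.
Qed.

Lemma dist3_le_sum (x y p x' y' p' : R) :
  dist3 (x, y, p) (x', y', p') <= Rabs (x - x') + Rabs (y - y') + Rabs (p - p').
Proof.
eapply Rle_trans; [apply (norm_prod_le_sum (V := R_NormedModule))|].
apply Rplus_le_compat_r.
apply (norm_prod_le_sum (U := R_NormedModule) (V := R_NormedModule)).
Qed.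

Lemma dist3_pos P Q : 0 <= dist3 P Q.
Proof. apply (norm_ge_0 (V := R3)). Qed.

(** A closed box rather than a ball: it is the set onto which coordinatewise clamping retracts the
    space. *)
Definition near3 (P0 : R * R * R) (r : R) (P : R * R * R) : Prop :=
  Rabs (fst (fst P) - fst (fst P0)) <= r /\ Rabs (snd (fst P) - snd (fst P0)) <= r /\
  Rabs (snd P - snd P0) <= r.

Definition lipschitz_near (P0 : R * R * R) (f : R * R * R -> R) : Prop :=
  exists (r : posreal) (L : R), 0 <= L /\
    forall P Q, near3 P0 r P -> near3 P0 r Q -> Rabs (f P - f Q) <= L * dist3 P Q.

Lemma near3_le P0 r r' P : r <= r' -> near3 P0 r P -> near3 P0 r' P.
Proof. intros H (H1 & H2 & H3); repeat split; lra. Qed.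

Lemma lipschitz_near_const P0 c : lipschitz_near P0 (fun _ => c).
Proof.
exists (mkposreal 1 Rlt_0_1), 0; split; [lra|]; intros.
rewrite Rminus_diag, Rabs_R0; lra.
Qed.

Lemma lipschitz_near_snd P0 : lipschitz_near P0 snd.
Proof.
exists (mkposreal 1 Rlt_0_1), 1; split; [lra|]; intros [[x y] p] [[x' y'] p'] _ _.
rewrite Rmult_1_l; apply dist3_coord.
Qed.

Lemma lipschitz_near_plus P0 f g :
  lipschitz_near P0 f -> lipschitz_near P0 g -> lipschitz_near P0 (fun P => f P + g P).
Proof.
intros (r & L & HL & Hf) (r' & L' & HL' & Hg).
assert (Hm : 0 < Rmin r r') by (apply Rmin_pos; apply cond_pos).
exists (mkposreal _ Hm), (L + L'); split; [lra|]; intros P Q HP HQ; simpl in *.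
replace (f P + g P - (f Q + g Q)) with ((f P - f Q) + (g P - g Q)) by ring.
apply Rle_trans with (1 := Rabs_triang _ _).
rewrite Rmult_plus_distr_r; apply Rplus_le_compat; [apply Hf | apply Hg];
  eapply near3_le; try eassumption; (apply Rmin_l || apply Rmin_r).
Qed.

Lemma lipschitz_near_mult P0 f g :
  lipschitz_near P0 f -> lipschitz_near P0 g -> lipschitz_near P0 (fun P => f P * g P).
Proof.
intros (r & L & HL & Hf) (r' & L' & HL' & Hg).
assert (Hm : 0 < Rmin r r') by (apply Rmin_pos; apply cond_pos).
(* Bounds the distance from P0 to any point of the box, so each factor is bounded on the box by its
   value at P0 plus its Lipschitz constant times B. *)
set (B := 3 * Rmin r r').
exists (mkposreal _ Hm), ((Rabs (f P0) + L * B) * L' + (Rabs (g P0) + L' * B) * L); split.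
{ unfold B; generalize (Rabs_pos (f P0)) (Rabs_pos (g P0)); intros.
  apply Rplus_le_le_0_compat; apply Rmult_le_pos; auto; apply Rplus_le_le_0_compat; auto;
  apply Rmult_le_pos; lra. }
intros P Q HP HQ; simpl in *.
assert (N0 : near3 P0 (Rmin r r') P0).
{ repeat split; rewrite Rminus_diag, Rabs_R0; lra. }
assert (Nr : forall P, near3 P0 (Rmin r r') P -> near3 P0 r P) by (intros; eapply near3_le; try eassumption; apply Rmin_l).
assert (Nr' : forall P, near3 P0 (Rmin r r') P -> near3 P0 r' P) by (intros; eapply near3_le; try eassumption; apply Rmin_r).
assert (HB : forall P, near3 P0 (Rmin r r') P -> dist3 P P0 <= B).
{ destruct P0 as [[x0 y0] p0]; intros [[x y] p] (H1 & H2 & H3); simpl in *.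
  apply Rle_trans with (1 := dist3_le_sum _ _ _ _ _ _); unfold B; lra. }
assert (Bf : Rabs (f P) <= Rabs (f P0) + L * B).
{ replace (f P) with (f P0 + (f P - f P0)) by ring.
  apply Rle_trans with (1 := Rabs_triang _ _), Rplus_le_compat_l.
  apply Rle_trans with (L * dist3 P P0); [now apply Hf; auto|].
  apply Rmult_le_compat_l; auto. }
assert (Bg : Rabs (g Q) <= Rabs (g P0) + L' * B).
{ replace (g Q) with (g P0 + (g Q - g P0)) by ring.
  apply Rle_trans with (1 := Rabs_triang _ _), Rplus_le_compat_l.
  apply Rle_trans with (L' * dist3 Q P0); [now apply Hg; auto|].
  apply Rmult_le_compat_l; auto. }
replace (f P * g P - f Q * g Q) with (f P * (g P - g Q) + g Q * (f P - f Q)) by ring.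
apply Rle_trans with (1 := Rabs_triang _ _).
rewrite 2!Rabs_mult, Rmult_plus_distr_r, 2!Rmult_assoc.
apply Rplus_le_compat; apply Rmult_le_compat; auto using Rabs_pos.
Qed.

Lemma is_derive_continuity_pt (f : R -> R) t l : is_derive f t l -> continuity_pt f t.
Proof.
intros H; apply continuity_pt_filterlim, (ex_derive_continuous (V := R_NormedModule)).
now exists l.
Qed.

(** The mean value theorem on the two legs of the path from (x', y') through (x', y) to (x, y), in a
    square where each partial exceeds its central value by at most 1. *)
Lemma lipschitz_near_base (f : R -> R -> R) P0 :
  smooth 1 f (fst (fst P0)) (snd (fst P0)) ->
  lipschitz_near P0 (fun P => f (fst (fst P)) (snd (fst P))).
Proof.
destruct P0 as [[x0 y0] p0]; simpl fst; simpl snd; intros (fx & fy & Hf & Hx & Hy).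
apply locally_2d_singleton in Hx; apply locally_2d_singleton in Hy.
destruct (locally_2d_and _ _ _ _ Hf (locally_2d_and _ _ _ _
  (Hx (mkposreal 1 Rlt_0_1)) (Hy (mkposreal 1 Rlt_0_1)))) as [e He].
assert (He2 : 0 < e / 2) by (generalize (cond_pos e); lra).
exists (mkposreal _ He2), ((Rabs (fx x0 y0) + 1) + (Rabs (fy x0 y0) + 1)).
split; [generalize (Rabs_pos (fx x0 y0)) (Rabs_pos (fy x0 y0)); lra|].
intros [[x y] p] [[x' y'] p'] (Hx1 & Hy1 & _) (Hx2 & Hy2 & _); simpl in *.
assert (Hbx : forall u v, Rabs (u - x0) < e -> Rabs (v - y0) < e -> Rabs (fx u v) <= Rabs (fx x0 y0) + 1).
{ intros u v Hu Hv; destruct (He u v Hu Hv) as (_ & H & _).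
  replace (fx u v) with (fx x0 y0 + (fx u v - fx x0 y0)) by ring.
  apply Rle_trans with (1 := Rabs_triang _ _); lra. }
assert (Hby : forall u v, Rabs (u - x0) < e -> Rabs (v - y0) < e -> Rabs (fy u v) <= Rabs (fy x0 y0) + 1).
{ intros u v Hu Hv; destruct (He u v Hu Hv) as (_ & _ & H).
  replace (fy u v) with (fy x0 y0 + (fy u v - fy x0 y0)) by ring.
  apply Rle_trans with (1 := Rabs_triang _ _); lra. }
assert (Hin : forall a b c t, Rabs (a - c) <= e / 2 -> Rabs (b - c) <= e / 2 ->
  Rmin a b <= t <= Rmax a b -> Rabs (t - c) < e).
{ intros a b c t Ha Hb Ht; apply Rabs_le_between in Ha; apply Rabs_le_between in Hb.
  apply Rle_lt_trans with (e / 2); [|lra]. apply Rabs_le.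
  unfold Rmin, Rmax in Ht; destruct Rle_dec in Ht; lra. }
destruct (MVT_gen (fun t => f t y) x' x (fun t => fx t y)) as (c1 & Hc1 & E1).
{ intros t Ht. apply He; [apply Hin with x' x; auto; lra | lra]. }
{ intros t Ht. apply (is_derive_continuity_pt (fun t => f t y) t (fx t y)).
  apply He; [apply Hin with x' x; auto | lra]. }
destruct (MVT_gen (fun t => f x' t) y' y (fun t => fy x' t)) as (c2 & Hc2 & E2).
{ intros t Ht. apply He; [lra | apply Hin with y' y; auto; lra]. }
{ intros t Ht. apply (is_derive_continuity_pt (fun t => f x' t) t (fy x' t)).
  apply He; [lra | apply Hin with y' y; auto]. }
replace (f x y - f x' y') with ((f x y - f x' y) + (f x' y - f x' y')) by ring.
rewrite E1, E2.
apply Rle_trans with (1 := Rabs_triang _ _).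
rewrite 2!Rabs_mult, Rmult_plus_distr_r.
destruct (dist3_coord x y p x' y' p') as (D1 & D2 & _).
apply Rplus_le_compat; apply Rmult_le_compat; auto using Rabs_pos.
- apply Hbx; [apply Hin with x' x; auto | lra].
- apply Hby; [lra | apply Hin with y' y; auto].
Qed.

Definition clamp (c r x : R) : R := Rmax (c - r) (Rmin x (c + r)).

Lemma clamp_near c r x : 0 < r -> Rabs (clamp c r x - c) <= r.
Proof.
intros Hr; apply Rabs_le; unfold clamp, Rmax, Rmin; repeat destruct Rle_dec; lra.
Qed.

Lemma clamp_id c r x : Rabs (x - c) <= r -> clamp c r x = x.
Proof.
intros H; apply Rabs_le_between in H.
unfold clamp, Rmax, Rmin; repeat destruct Rle_dec; lra.
Qed.

Lemma clamp_lip c r x y : Rabs (clamp c r x - clamp c r y) <= Rabs (x - y).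
Proof.
unfold clamp, Rmax, Rmin; repeat destruct Rle_dec; unfold Rabs; repeat destruct Rcase_abs; lra.
Qed.

Lemma is_derive_pair {U V : NormedModule R_AbsRing} (gam : R -> U * V) t l :
  is_derive (V := prod_NormedModule _ U V) gam t l ->
  is_derive (fun s => fst (gam s)) t (fst l) /\ is_derive (fun s => snd (gam s)) t (snd l).
Proof.
intros H; split.
- apply (filterdiff_comp' (U := R_NormedModule) (V := prod_NormedModule _ U V) gam fst t _ fst H).
  apply filterdiff_linear, is_linear_fst.
- apply (filterdiff_comp' (U := R_NormedModule) (V := prod_NormedModule _ U V) gam snd t _ snd H).
  apply filterdiff_linear, is_linear_snd.
Qed.

Lemma is_derive_triple (gam : R -> R * R * R) t l :
  is_derive (V := R3) gam t l ->
  is_derive (fun s => fst (fst (gam s))) t (fst (fst l)) /\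
  is_derive (fun s => snd (fst (gam s))) t (snd (fst l)) /\
  is_derive (fun s => snd (gam s)) t (snd l).
Proof.
intros H; apply is_derive_pair in H; destruct H as [H1 H3].
apply is_derive_pair in H1; tauto.
Qed.

(* The field is composed with the clamp to a box, which makes it globally Lipschitz. *)
Lemma ode_local_existence (V1 V2 V3 : R * R * R -> R) (P0 : R * R * R) :
  lipschitz_near P0 V1 -> lipschitz_near P0 V2 -> lipschitz_near P0 V3 ->
  exists (eps : posreal) (gam : R -> R * R * R), gam 0 = P0 /\
    forall t, Rabs t < eps ->
      is_derive (V := R3) gam t (V1 (gam t), V2 (gam t), V3 (gam t)).
Proof.
intros (r1 & L1 & HL1 & H1) (r2 & L2 & HL2 & H2) (r3 & L3 & HL3 & H3).
set (r := Rmin r1 (Rmin r2 r3)).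
assert (Hr : 0 < r) by (unfold r; repeat apply Rmin_pos; apply cond_pos).
assert (R1 : r <= r1) by apply Rmin_l.
assert (R2 : r <= r2) by (eapply Rle_trans; [apply Rmin_r | apply Rmin_l]).
assert (R3' : r <= r3) by (eapply Rle_trans; [apply Rmin_r | apply Rmin_r]).
destruct P0 as [[x0 y0] p0].
set (kap := fun P : R * R * R => (clamp x0 r (fst (fst P)), clamp y0 r (snd (fst P)), clamp p0 r (snd P))).
assert (Hk : forall P, near3 (x0, y0, p0) r (kap P)).
{ intros P; repeat split; now apply clamp_near. }
assert (Hkl : forall P Q, dist3 (kap P) (kap Q) <= 3 * dist3 P Q).
{ intros [[x y] p] [[x' y'] p']; unfold kap; simpl.
  eapply Rle_trans; [apply dist3_le_sum|].
  destruct (dist3_coord x y p x' y' p') as (D1 & D2 & D3).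
  generalize (clamp_lip x0 r x x') (clamp_lip y0 r y y') (clamp_lip p0 r p p'); lra. }
set (f := fun P => (V1 (kap P), V2 (kap P), V3 (kap P))).
(* The factor 3 is the Lipschitz constant found for the clamp in the product norm; the + 1 makes the
   constant strictly positive. *)
destruct (@picard R3_complete f (3 * (L1 + L2 + L3) + 1) (x0, y0, p0)) as (eps & gam & G0 & HG).
{ lra. }
{ intros P Q. change (dist3 (f P) (f Q) <= (3 * (L1 + L2 + L3) + 1) * dist3 P Q).
  eapply Rle_trans; [apply dist3_le_sum|].
  assert (E1 := H1 (kap P) (kap Q) (near3_le _ _ _ _ R1 (Hk P)) (near3_le _ _ _ _ R1 (Hk Q))).
  assert (E2 := H2 (kap P) (kap Q) (near3_le _ _ _ _ R2 (Hk P)) (near3_le _ _ _ _ R2 (Hk Q))).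
  assert (E3 := H3 (kap P) (kap Q) (near3_le _ _ _ _ R3' (Hk P)) (near3_le _ _ _ _ R3' (Hk Q))).
  generalize (dist3_pos P Q) (Hkl P Q); intros D0 D1.
  apply (Rmult_le_compat_l (L1 + L2 + L3)) in D1; lra. }
(* By continuity the curve stays in the box for short times. There the clamp is the identity, so the
   curve solves the original equation. *)
assert (Hloc : locally 0 (fun t => near3 (x0, y0, p0) r (gam t))).
{ assert (Hd := HG 0 ltac:(rewrite Rabs_R0; apply cond_pos)).
  change (is_derive (V := R3) gam 0 (f (gam 0))) in Hd.
  assert (Hc : continuous (U := R3) gam 0) by (apply ex_derive_continuous; eexists; exact Hd).
  assert (Hb := proj1 (filterlim_locally (F := locally 0) (U := R3) _ _) Hc (mkposreal _ Hr)).
  revert Hb; apply filter_imp; intros t Ht; rewrite G0 in Ht.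
  destruct Ht as [[B1 B2] B3].
  repeat split; left; [exact B1 | exact B2 | exact B3]. }
destruct Hloc as [e He].
assert (Hm : 0 < Rmin eps e) by (apply Rmin_pos; apply cond_pos).
exists (mkposreal _ Hm), gam; split; [auto|]; simpl; intros t Ht.
assert (Hn : near3 (x0, y0, p0) r (gam t)).
{ apply He. change (Rabs (t - 0) < e). rewrite Rminus_0_r.
  apply Rlt_le_trans with (1 := Ht), Rmin_r. }
replace (V1 (gam t), V2 (gam t), V3 (gam t)) with (f (gam t)).
- apply HG. apply Rlt_le_trans with (1 := Ht), Rmin_l.
- unfold f; replace (kap (gam t)) with (gam t); auto.
  destruct Hn as (N1 & N2 & N3); unfold kap; simpl in N1, N2, N3.
  rewrite !clamp_id by auto. now destruct (gam t) as [[? ?] ?].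
Qed.

(** * Graphs at parabolic points *)


Section Pointwise.
Variable z : R -> R -> R.

Definition area2 (x y : R) : R := 1 + z_x z x y ^ 2 + z_y z x y ^ 2.

Definition hessian_det (x y : R) : R :=
  partial_derive 2 0 z x y * partial_derive 0 2 z x y - partial_derive 1 1 z x y ^ 2.

Lemma area2_pos x y : 0 < area2 x y.
Proof. unfold area2; nra. Qed.

Lemma area_W_pos x y : 0 < area_W z x y.
Proof. apply sqrt_lt_R0, area2_pos. Qed.

Lemma area_W_sqr x y : area_W z x y ^ 2 = area2 x y.
Proof. apply pow2_sqrt; left; apply area2_pos. Qed.

Lemma char_a_area2 x y : char_a z x y = area2 x y.
Proof. unfold char_a, I_E, I_F, I_G, area2; ring. Qed.

Lemma char_c_hessian x y : char_c z x y = hessian_det x y / area2 x y.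
Proof.
unfold char_c, II_e, II_f, II_g, hessian_det; rewrite <- area_W_sqr.
field; apply Rgt_not_eq, area_W_pos.
Qed.

(* A pencil of quadratic forms with a definite member has real roots: E^2 times the
   discriminant is a sum of two squares with positive weights. *)
Lemma char_discriminant_nonneg x y :
  0 <= char_b z x y ^ 2 - 4 * char_a z x y * char_c z x y.
Proof.
assert (HE : 0 < I_E z x y) by (unfold I_E; nra).
assert (HD : 0 < I_E z x y * I_G z x y - I_F z x y ^ 2).
{ change (0 < char_a z x y); rewrite char_a_area2; apply area2_pos. }
apply Rmult_le_reg_l with (I_E z x y ^ 2); [now apply pow_lt|].
rewrite Rmult_0_r; unfold char_a, char_b, char_c.
set (E := I_E z x y) in *; set (F := I_F z x y) in *; set (G := I_G z x y) in *.
set (e := II_e z x y); set (f := II_f z x y); set (g := II_g z x y).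
replace (E ^ 2 * ((e * G - 2 * f * F + g * E) ^ 2 - 4 * (E * G - F ^ 2) * (e * g - f ^ 2)))
 with (4 * (E * G - F ^ 2) * (E * f - F * e) ^ 2
       + (E * (E * g - G * e) - 2 * F * (E * f - F * e)) ^ 2) by ring.
generalize (pow2_ge_0 (E * f - F * e)) (pow2_ge_0 (E * (E * g - G * e) - 2 * F * (E * f - F * e))).
intros; apply Rplus_le_le_0_compat; auto; apply Rmult_le_pos; lra.
Qed.

(** The product of the roots of the characteristic quadratic is char_c / char_a; the discriminant
    being nonnegative, the square root cancels. The resulting formula is rational in the derivatives
    of z, which gives the smoothness of K. *)
Lemma gauss_K_hessian x y : gauss_K z x y = hessian_det x y / area2 x y ^ 2.
Proof.
assert (Ha := area2_pos x y).
replace (hessian_det x y / area2 x y ^ 2) with (char_c z x y / char_a z x y)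
  by (rewrite char_c_hessian, char_a_area2; field; lra).
assert (Ha' : 0 < char_a z x y) by now rewrite char_a_area2.
unfold gauss_K, principal_k1, principal_k2.
assert (Hs := pow2_sqrt _ (char_discriminant_nonneg x y)).
set (s := sqrt _) in *.
replace ((char_b z x y - s) / (2 * char_a z x y) * ((char_b z x y + s) / (2 * char_a z x y)))
  with ((char_b z x y ^ 2 - s ^ 2) / (4 * char_a z x y ^ 2)) by (field; lra).
rewrite Hs; field; lra.
Qed.

Lemma first_form_pos x y u v : (u, v) <> (0, 0) -> 0 < first_form z x y u v.
Proof.
intros Huv; unfold first_form, I_E, I_F, I_G.
set (P := z_x z x y); set (Q := z_y z x y).
replace ((1 + P ^ 2) * u ^ 2 + 2 * (P * Q) * u * v + (1 + Q ^ 2) * v ^ 2)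
  with (u ^ 2 + v ^ 2 + (P * u + Q * v) ^ 2) by ring.
assert (0 < u ^ 2 + v ^ 2).
{ destruct (Req_dec u 0) as [->|Hu]; [destruct (Req_dec v 0) as [->|Hv]|].
  - now destruct Huv.
  - generalize (pow2_gt_0 v Hv); nra.
  - generalize (pow2_gt_0 u Hu) (pow2_ge_0 v); lra. }
generalize (pow2_ge_0 (P * u + Q * v)); lra.
Qed.

(** * Parabolic points with z_yy > 0 *)

Section Parabolic.
Variables x y : R.
Hypothesis Hg : 0 < partial_derive 0 2 z x y.
Hypothesis HK : gauss_K z x y = 0.

(** The slope of the null direction of the second form: the double root of z_yy p^2 + 2 z_xy p +
    z_xx. *)
Let p0 := - partial_derive 1 1 z x y / partial_derive 0 2 z x y.

Lemma parabolic_hessian :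
  partial_derive 1 1 z x y = - p0 * partial_derive 0 2 z x y /\
  partial_derive 2 0 z x y = p0 ^ 2 * partial_derive 0 2 z x y.
Proof.
assert (Ha := area2_pos x y). rewrite gauss_K_hessian in HK.
assert (H : hessian_det x y = 0).
{ replace (hessian_det x y) with (hessian_det x y / area2 x y ^ 2 * area2 x y ^ 2) by (field; lra).
  rewrite HK; ring. }
unfold hessian_det in H; unfold p0; split; [field; lra|].
apply Rmult_eq_reg_r with (partial_derive 0 2 z x y); [|lra].
replace ((- partial_derive 1 1 z x y / partial_derive 0 2 z x y) ^ 2 * partial_derive 0 2 z x y
  * partial_derive 0 2 z x y) with (partial_derive 1 1 z x y ^ 2) by (field; lra).
lra.
Qed.

Lemma parabolic_second_form u v :
  second_form z x y u v = partial_derive 0 2 z x y / area_W z x y * (v - p0 * u) ^ 2.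
Proof.
destruct parabolic_hessian as [H1 H2].
unfold second_form, II_e, II_f, II_g; rewrite H1, H2.
field; apply Rgt_not_eq, area_W_pos.
Qed.

Lemma parabolic_k1 : principal_k1 z x y = 0.
Proof.
assert (HW := area_W_pos x y).
destruct parabolic_hessian as [H1 H2].
assert (Hc : char_c z x y = 0).
{ rewrite char_c_hessian; unfold hessian_det; rewrite H1, H2; field.
  apply Rgt_not_eq, area2_pos. }
(* With char_c = 0 the roots are 0 and char_b / char_a; positivity of char_b, which comes from z_yy
   > 0, makes 0 the smaller one. *)
assert (Hb : 0 < char_b z x y).
{ replace (char_b z x y) with (II_g z x y * first_form z x y 1 p0).
  - apply Rmult_lt_0_compat; [now apply Rdiv_lt_0_compat|].
    apply first_form_pos; intros E; injection E; lra.
  - unfold char_b, first_form, II_e, II_f, II_g; rewrite H1, H2; field; lra. }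
unfold principal_k1; rewrite Hc, Rmult_0_r, Rminus_0_r, sqrt_pow2 by lra.
unfold Rdiv; rewrite Rminus_diag; ring.
Qed.

Lemma parabolic_minimal_direction : minimal_principal_direction z x y 1 p0.
Proof.
destruct parabolic_hessian as [H1 H2].
assert (HW := area_W_pos x y).
split; [intros E; injection E; lra|].
rewrite parabolic_k1; unfold II_e, II_f, II_g; rewrite H1, H2.
split; field; lra.
Qed.

Lemma parabolic_M_direction m u v :
  surface_M z m x y = 0 -> M_direction z m x y u v -> u <> 0 /\ v = p0 * u.
Proof.
intros HM (Huv & Hn).
assert (HI := first_form_pos x y u v Huv).
rewrite HM in Hn; unfold normal_curvature in Hn.
assert (HII : second_form z x y u v = 0).
{ replace (second_form z x y u v) with (second_form z x y u v / first_form z x y u v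
    * first_form z x y u v) by (field; lra).
  rewrite Hn; ring. }
rewrite parabolic_second_form in HII.
assert (Hv : v = p0 * u).
{ apply Rmult_integral in HII; destruct HII as [H|H].
  - exfalso; generalize (Rdiv_lt_0_compat _ _ Hg (area_W_pos x y)); lra.
  - destruct (Req_dec (v - p0 * u) 0) as [|Hne]; [lra|].
    generalize (pow2_gt_0 _ Hne); lra. }
split; auto; intros Hu; apply Huv; rewrite Hv, Hu; f_equal; ring.
Qed.

Lemma parabolic_roots M p : M x y = 0 -> M_equation z M x y p = 0 <-> p = p0.
Proof.
intros HM.
assert (HW := Rdiv_lt_0_compat _ _ Hg (area_W_pos x y)).
assert (E : M_equation z M x y p = second_form z x y 1 p).
{ unfold M_equation, second_form; rewrite HM; ring. }
rewrite E, parabolic_second_form, Rmult_1_r; split; intros H.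
- apply Rmult_integral in H; destruct H as [H|H]; [lra|].
  destruct (Req_dec (p - p0) 0) as [|Hne]; [lra|].
  generalize (pow2_gt_0 _ Hne); lra.
- rewrite H; ring.
Qed.
End Parabolic.

Lemma M_direction_of_root m M x y p u v :
  M_equation z M x y p = 0 -> surface_M z m x y = M x y -> u <> 0 -> v = p * u ->
  M_direction z m x y u v.
Proof.
intros HF HM Hu Hv.
assert (Huv : (u, v) <> (0, 0)) by (intros E; injection E; lra).
split; auto.
assert (HI := first_form_pos x y u v Huv).
unfold normal_curvature; apply Rmult_eq_reg_r with (first_form z x y u v); [|lra].
replace (second_form z x y u v / first_form z x y u v * first_form z x y u v)
  with (second_form z x y u v) by (field; lra).
rewrite HM; apply Rminus_diag_uniq.
replace (second_form z x y u v - M x y * first_form z x y u v) with (u ^ 2 * M_equation z M x y p).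
- rewrite HF; ring.
- unfold second_form, first_form, M_equation; rewrite Hv; ring.
Qed.
End Pointwise.

(** * Quadratic implicit equations near a regular fold *)


(** Every derivative is identified on a whole neighbourhood before the next one is taken. Since be''
    = p1 q + p q1, one derivative of [p1] and of [q1] is what the third derivatives require. *)
Lemma cusp_of_lift (al be p q p1 q1 : R -> R) :
  locally 0 (fun t => is_derive al t (q t) /\ is_derive be t (p t * q t) /\
    is_derive p t (p1 t) /\ is_derive q t (q1 t) /\ ex_derive p1 t /\ ex_derive q1 t) ->
  q 0 = 0 -> q1 0 <> 0 -> p1 0 <> 0 -> cusp_tangent_to al be 1 (p 0).
Proof.
intros H Hq Hq1 Hp1.
assert (A1 : locally 0 (fun t => Derive_n al 1 t = q t)).
{ revert H; apply filter_imp; intros t (H & _); now apply is_derive_unique. }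
assert (B1 : locally 0 (fun t => Derive_n be 1 t = p t * q t)).
{ revert H; apply filter_imp; intros t (_ & H & _); now apply is_derive_unique. }
assert (A2 : locally 0 (fun t => is_derive (Derive_n al 1) t (q1 t))).
{ generalize (filter_and _ _ (locally_locally _ _ A1) H); apply filter_imp; intros t (E & HH).
  apply (is_derive_ext_loc q); [|tauto]. revert E; now apply filter_imp. }
assert (B2 : locally 0 (fun t => is_derive (Derive_n be 1) t (p1 t * q t + p t * q1 t))).
{ generalize (filter_and _ _ (locally_locally _ _ B1) H); apply filter_imp; intros t (E & HH).
  apply (is_derive_ext_loc (fun t => p t * q t)); [revert E; now apply filter_imp|].
  apply Derive.is_derive_mult; tauto. }
assert (A2' : locally 0 (fun t => Derive_n al 2 t = q1 t)).
{ revert A2; apply filter_imp; intros t E; now apply is_derive_unique. }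
assert (B2' : locally 0 (fun t => Derive_n be 2 t = p1 t * q t + p t * q1 t)).
{ revert B2; apply filter_imp; intros t E; now apply is_derive_unique. }
assert (A3 : locally 0 (fun t => ex_derive (Derive_n al 2) t)).
{ generalize (filter_and _ _ (locally_locally _ _ A2') H); apply filter_imp; intros t (E & HH).
  apply (ex_derive_ext_loc q1); [|tauto]. revert E; now apply filter_imp. }
assert (B3 : locally 0 (fun t => is_derive (Derive_n be 2) t
  ((Derive p1 t * q t + p1 t * q1 t) + (p1 t * q1 t + p t * Derive q1 t)))).
{ generalize (filter_and _ _ (locally_locally _ _ B2') H); apply filter_imp.
  intros t (E & D1 & D2 & D3 & D4 & D5 & D6).
  apply (is_derive_ext_loc (fun t => p1 t * q t + p t * q1 t)); [revert E; now apply filter_imp|].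
  apply (is_derive_plus (fun t => p1 t * q t) (fun t => p t * q1 t)); apply Derive.is_derive_mult; auto; now apply Derive_correct. }
assert (A20 := locally_singleton _ _ A2'). assert (B20 := locally_singleton _ _ B2').
assert (A10 := locally_singleton _ _ A1). assert (B10 := locally_singleton _ _ B1).
assert (B30 : Derive_n be 3 0 = 2 * p1 0 * q1 0 + p 0 * Derive q1 0).
{ replace (2 * p1 0 * q1 0 + p 0 * Derive q1 0) with
    ((Derive p1 0 * q 0 + p1 0 * q1 0) + (p1 0 * q1 0 + p 0 * Derive q1 0)) by (rewrite Hq; ring).
  apply is_derive_unique, (locally_singleton _ _ B3). }
assert (A30 : Derive_n al 3 0 = Derive q1 0) by now apply Derive_ext_loc.
cbv beta in *.
split; [|split; [|split; [|split]]].
- intros n Hn; destruct n as [|[|[|[|n]]]]; [| | | | lia].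
  + now apply filter_forall.
  + revert H; apply filter_imp; intros t (D1 & D2 & _); split; eexists; eassumption.
  + generalize (filter_and _ _ A2 B2); apply filter_imp; intros t (D1 & D2); split; eexists; eassumption.
  + generalize (filter_and _ _ A3 B3); apply filter_imp; intros t (D1 & D2); split; [exact D1 | eexists; eassumption].
- change (Derive_n al 1 0 = 0); now rewrite A10.
- change (Derive_n be 1 0 = 0); rewrite B10, Hq; ring.
- exists (q1 0); rewrite A20, B20, Hq; repeat split; auto; ring.
- rewrite A20, B20, B30, A30, Hq.
  replace (q1 0 * (2 * p1 0 * q1 0 + p 0 * Derive q1 0) - (p1 0 * 0 + p 0 * q1 0) * Derive q1 0)
    with (2 * p1 0 * q1 0 ^ 2) by ring.
  apply Rmult_integral_contrapositive_currified; [lra | now apply pow_nonzero].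
Qed.

Lemma sign_of_simple_zero (q : R -> R) (l : R) :
  q 0 = 0 -> is_derive q 0 l -> 0 < l -> locally' 0 (fun t => 0 < t * q t).
Proof.
intros Hq Hd Hl; apply is_derive_Reals in Hd.
destruct (Hd (l / 2) ltac:(lra)) as [e He].
exists e; intros t Ht Hne; change (Rabs (t - 0) < e) in Ht; rewrite Rminus_0_r in Ht.
specialize (He t Hne Ht). rewrite Rplus_0_l, Hq, Rminus_0_r in He.
apply Rabs_def2 in He.
assert (0 < q t / t) by lra.
replace (t * q t) with (t ^ 2 * (q t / t)) by (field; auto).
apply Rmult_lt_0_compat; auto; now apply pow2_gt_0.
Qed.

(** The mean value theorem gives g t = w c * t with c strictly between 0 and t, so that w c has the
    sign of t. *)
Lemma positive_of_strict_minimum (g w : R -> R) :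
  g 0 = 0 -> locally 0 (fun t => is_derive g t (w t)) -> locally' 0 (fun t => 0 < t * w t) ->
  locally' 0 (fun t => 0 < g t).
Proof.
intros Hg [e1 H1] [e2 H2].
assert (Hm : 0 < Rmin e1 e2) by (apply Rmin_pos; apply cond_pos).
exists (mkposreal _ Hm); simpl; intros t Ht Hne.
change (Rabs (t - 0) < Rmin e1 e2) in Ht; rewrite Rminus_0_r in Ht.
assert (T1 : Rabs t < e1) by (apply Rlt_le_trans with (1 := Ht), Rmin_l).
assert (T2 : Rabs t < e2) by (apply Rlt_le_trans with (1 := Ht), Rmin_r).
assert (Hin : forall s, Rmin 0 t <= s <= Rmax 0 t -> Rabs s <= Rabs t).
{ intros s; unfold Rmin, Rmax, Rabs; repeat destruct Rle_dec; repeat destruct Rcase_abs; lra. }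
assert (Hder : forall s, Rmin 0 t <= s <= Rmax 0 t -> is_derive g s (w s)).
{ intros s Hs; apply H1; change (Rabs (s - 0) < e1); rewrite Rminus_0_r.
  apply Rle_lt_trans with (2 := T1); auto. }
assert (exists c, (0 < c < t \/ t < c < 0) /\ g t = w c * t) as (c & Hc & E).
{ destruct (Rtotal_order t 0) as [Lt|[|Gt]]; [|lra|].
  - destruct (MVT_cor2 g w t 0 Lt) as (c & E & Hc).
    + intros s Hs; apply is_derive_Reals, Hder; rewrite Rmin_right, Rmax_left; lra.
    + exists c; split; [lra|]. lra.
  - destruct (MVT_cor2 g w 0 t Gt) as (c & E & Hc).
    + intros s Hs; apply is_derive_Reals, Hder; rewrite Rmin_left, Rmax_right; lra.
    + exists c; split; [lra|]. lra. }
assert (Hc0 : 0 < c * w c).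
{ apply H2; [|lra]; change (Rabs (c - 0) < e2); rewrite Rminus_0_r.
  apply Rle_lt_trans with (2 := T2); apply Hin.
  unfold Rmin, Rmax; repeat destruct Rle_dec; lra. }
rewrite E; destruct Hc as [Hc|Hc]; nra.
Qed.

Lemma is_derive_quadratic_coef (a b c : R -> R) (p t a' b' c' : R) :
  is_derive a t a' -> is_derive b t b' -> is_derive c t c' ->
  is_derive (fun s => a s * p ^ 2 + 2 * b s * p + c s) t (a' * p ^ 2 + 2 * b' * p + c').
Proof.
intros Ha Hb Hc; auto_derive.
- repeat split; eexists; eassumption.
- replace (Derive (fun x : R => a x) t) with a' by (symmetry; now apply is_derive_unique).
  replace (Derive (fun x : R => b x) t) with b' by (symmetry; now apply is_derive_unique).
  replace (Derive (fun x : R => c x) t) with c' by (symmetry; now apply is_derive_unique).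
  ring.
Qed.

(** The expression is x'' along an integral curve, the coefficients and their partials being
    composed with the curve; [ex_derive_lift_slope] treats p' likewise. *)
Lemma ex_derive_lift_speed (a ax ay bx bY p q p1 : R -> R) (t : R) :
  ex_derive a t -> ex_derive ax t -> ex_derive ay t -> ex_derive bx t -> ex_derive bY t ->
  ex_derive p t -> ex_derive q t -> ex_derive p1 t ->
  ex_derive (fun s => 2 * ((ax s + p s * ay s) * q s * p s + a s * p1 s +
    (bx s + p s * bY s) * q s)) t.
Proof. intros; auto_derive; tauto. Qed.

Lemma ex_derive_lift_slope (ax ay bx bY cx cy p : R -> R) (t : R) :
  ex_derive ax t -> ex_derive ay t -> ex_derive bx t -> ex_derive bY t ->
  ex_derive cx t -> ex_derive cy t -> ex_derive p t ->
  ex_derive (fun s => - ((ax s * p s ^ 2 + 2 * bx s * p s + cx s) +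
     p s * (ay s * p s ^ 2 + 2 * bY s * p s + cy s))) t.
Proof. intros; auto_derive; tauto. Qed.

Lemma is_derive_fold (a b p : R -> R) (t a' b' p' : R) :
  is_derive a t a' -> is_derive b t b' -> is_derive p t p' ->
  is_derive (fun s => 2 * (a s * p s + b s)) t (2 * (a' * p t + a t * p' + b')).
Proof.
intros Ha Hb Hp; apply is_derive_scal.
apply (is_derive_plus (fun s => a s * p s) b); auto.
now apply Derive.is_derive_mult.
Qed.

Lemma is_derive_quadratic_curve (a b c p : R -> R) (t a' b' c' p' : R) :
  is_derive a t a' -> is_derive b t b' -> is_derive c t c' -> is_derive p t p' ->
  is_derive (fun s => a s * p s ^ 2 + 2 * b s * p s + c s) t
    (a' * p t ^ 2 + 2 * b' * p t + c' + 2 * (a t * p t + b t) * p').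
Proof.
intros Ha Hb Hc Hp.
replace (a' * p t ^ 2 + 2 * b' * p t + c' + 2 * (a t * p t + b t) * p') with
  ((a' * p t + a t * p') * p t + a t * p t * p' + 2 * (b' * p t + b t * p') + c') by ring.
apply (is_derive_plus (fun s => a s * p s ^ 2 + 2 * b s * p s) c); auto.
apply (is_derive_plus (fun s => a s * p s ^ 2) (fun s => 2 * b s * p s)).
- apply (is_derive_ext (fun s => a s * p s * p s)); [intros; simpl; ring|].
  apply (Derive.is_derive_mult (fun s => a s * p s) p); auto.
  now apply Derive.is_derive_mult.
- apply (is_derive_ext (fun s => 2 * (b s * p s))); [intros; simpl; ring|].
  apply is_derive_scal; now apply Derive.is_derive_mult.
Qed.

Lemma is_derive_zero_constant (f : R -> R) (e : R) :
  (forall t, Rabs t < e -> is_derive f t 0) -> forall t, Rabs t < e -> f t = f 0.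
Proof.
intros H t Ht.
assert (Hin : forall s, Rmin 0 t <= s <= Rmax 0 t -> Rabs s < e).
{ intros s; revert Ht; unfold Rmin, Rmax, Rabs; repeat destruct Rle_dec; repeat destruct Rcase_abs; lra. }
destruct (MVT_gen f 0 t (fun _ => 0)) as (c & _ & E).
- intros s Hs; apply H, Hin; lra.
- intros s Hs; apply (is_derive_continuity_pt f s 0), H, Hin; lra.
- lra.
Qed.

Section Quadratic.
Variables al be ga alx aly bex bey gax gay : R -> R -> R.

Definition quadratic (x y p : R) : R := al x y * p ^ 2 + 2 * be x y * p + ga x y.

Definition quadratic_x (x y p : R) : R := alx x y * p ^ 2 + 2 * bex x y * p + gax x y.
Definition quadratic_y (x y p : R) : R := aly x y * p ^ 2 + 2 * bey x y * p + gay x y.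
Definition quadratic_p (x y p : R) : R := 2 * (al x y * p + be x y).

(** The Lie-Cartan field with named partials in place of [Derive]. The two are identified at base
    points satisfying [quadratic_partials], so a curve must be kept near its starting point before
    they are exchanged. *)
Definition quadratic_field (P : R * R * R) : R * R * R :=
  let x := fst (fst P) in let y := snd (fst P) in let p := snd P in
  (quadratic_p x y p, p * quadratic_p x y p, - (quadratic_x x y p + p * quadratic_y x y p)).

(** Coefficients of class C^2, hence a Lie-Cartan field of class C^1. *)
Definition quadratic_partials (x y : R) : Prop :=
  partials al alx aly x y /\ partials be bex bey x y /\ partials ga gax gay x y /\
  (smooth 1 alx x y /\ smooth 1 aly x y) /\ (smooth 1 bex x y /\ smooth 1 bey x y) /\
  (smooth 1 gax x y /\ smooth 1 gay x y).

Lemma quadratic_partials_open x y :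
  quadratic_partials x y -> locally_2d quadratic_partials x y.
Proof.
intros (H1 & H2 & H3 & (H4 & H5) & (H6 & H7) & H8 & H9).
generalize (locally_2d_and _ _ _ _ (partials_open _ _ _ _ _ H1)
 (locally_2d_and _ _ _ _ (partials_open _ _ _ _ _ H2)
 (locally_2d_and _ _ _ _ (partials_open _ _ _ _ _ H3)
 (locally_2d_and _ _ _ _ (smooth_open _ _ _ _ H4)
 (locally_2d_and _ _ _ _ (smooth_open _ _ _ _ H5)
 (locally_2d_and _ _ _ _ (smooth_open _ _ _ _ H6)
 (locally_2d_and _ _ _ _ (smooth_open _ _ _ _ H7)
 (locally_2d_and _ _ _ _ (smooth_open _ _ _ _ H8) (smooth_open _ _ _ _ H9))))))))).
apply locally_2d_imp; unfold quadratic_partials; tauto.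
Qed.

Lemma F_p_quadratic x y p : F_p quadratic x y p = quadratic_p x y p.
Proof.
apply is_derive_unique; unfold quadratic, quadratic_p; auto_derive; auto; ring.
Qed.

Lemma partials_quadratic p x y :
  quadratic_partials x y ->
  partials (fun u v => quadratic u v p) (fun u v => quadratic_x u v p) (fun u v => quadratic_y u v p) x y.
Proof.
intros (H1 & H2 & H3 & _).
generalize (locally_2d_and _ _ _ _ H1 (locally_2d_and _ _ _ _ H2 H3)).
unfold quadratic, quadratic_x, quadratic_y.
apply locally_2d_imp; intros u v ((A1 & A2) & (B1 & B2) & C1 & C2); split.
- now apply (is_derive_quadratic_coef (fun t => al t v) (fun t => be t v) (fun t => ga t v)).
- now apply (is_derive_quadratic_coef (fun t => al u t) (fun t => be u t) (fun t => ga u t)).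
Qed.

Lemma lie_cartan_quadratic x y p :
  quadratic_partials x y -> lie_cartan quadratic (x, y, p) = quadratic_field (x, y, p).
Proof.
intros H; generalize (locally_2d_singleton _ _ _ (partials_quadratic p x y H)); intros [H1 H2].
unfold lie_cartan, quadratic_field; simpl fst; simpl snd.
rewrite F_p_quadratic.
replace (F_x quadratic x y p) with (quadratic_x x y p) by (symmetry; now apply is_derive_unique).
now replace (F_y quadratic x y p) with (quadratic_y x y p) by (symmetry; now apply is_derive_unique).
Qed.

Lemma quadratic_partials_smooth x y : quadratic_partials x y ->
  smooth 1 al x y /\ smooth 1 be x y /\ smooth 1 ga x y.
Proof.
intros (H1 & H2 & H3 & (H4 & H5) & (H6 & H7) & H8 & H9).
repeat split; eexists; eexists; (split; [eassumption|]); split; now apply smooth_pred.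
Qed.

Lemma quadratic_integral_curve_exists x0 y0 p0 : quadratic_partials x0 y0 ->
  exists (eps : posreal) (gam : R -> R * R * R),
    integral_curve quadratic eps gam /\ gam 0 = (x0, y0, p0).
Proof.
intros H.
destruct (quadratic_partials_smooth _ _ H) as (Sa & Sb & Sg).
destruct (quadratic_partials_open _ _ H) as [e He].
destruct H as (_ & _ & _ & (H4 & H5) & (H6 & H7) & H8 & H9).
set (P0 := (x0, y0, p0)).
assert (Lp := lipschitz_near_snd P0).
assert (L2 : forall f g, lipschitz_near P0 f -> lipschitz_near P0 g -> lipschitz_near P0 (fun P => f P * g P)) by
  apply lipschitz_near_mult.
assert (Lq : forall a b c, smooth 1 a x0 y0 -> smooth 1 b x0 y0 -> smooth 1 c x0 y0 ->
  lipschitz_near P0 (fun P => a (fst (fst P)) (snd (fst P)) * snd P ^ 2 +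
    2 * b (fst (fst P)) (snd (fst P)) * snd P + c (fst (fst P)) (snd (fst P)))).
{ intros a b c Ha Hb Hc.
  apply (lipschitz_near_plus P0 (fun P => _ + _)); [|now apply lipschitz_near_base].
  apply (lipschitz_near_plus P0 (fun P => _ * _) (fun P => _ * _)).
  - apply (lipschitz_near_mult P0 (fun P => a _ _)); [now apply lipschitz_near_base|].
    (* The trailing factor 1 is the end of the unfolded power snd P ^ 2. *)
    apply (lipschitz_near_mult P0 snd (fun P => snd P * 1)); auto.
    apply lipschitz_near_mult; auto. apply lipschitz_near_const.
  - apply lipschitz_near_mult; auto.
    apply lipschitz_near_mult; [apply lipschitz_near_const | now apply lipschitz_near_base]. }
assert (Lqp : lipschitz_near P0 (fun P => quadratic_p (fst (fst P)) (snd (fst P)) (snd P))).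
{ apply lipschitz_near_mult; [apply lipschitz_near_const|].
  apply (lipschitz_near_plus P0 (fun P => _ * _)); [|now apply lipschitz_near_base].
  apply (lipschitz_near_mult P0 (fun P => al _ _)); auto. now apply lipschitz_near_base. }
assert (Lq1 := Lq _ _ _ H4 H6 H8). assert (Lq2 := Lq _ _ _ H5 H7 H9).
destruct (ode_local_existence _ _ (fun P => -1 * (quadratic_x (fst (fst P)) (snd (fst P)) (snd P) +
   snd P * quadratic_y (fst (fst P)) (snd (fst P)) (snd P))) P0 Lqp (L2 _ _ Lp Lqp)) as (eps & gam & G0 & HG).
{ apply L2; [apply lipschitz_near_const|].
  apply (lipschitz_near_plus P0 (fun P => quadratic_x _ _ _)); [exact Lq1 | apply L2; [auto | exact Lq2]]. }
(* The curve found solves [quadratic_field]; it is an integral curve of [lie_cartan] while its base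
   point stays where the partials are known, so the time interval is shortened. *)
assert (Hloc : locally 0 (fun t => quadratic_partials (fst (fst (gam t))) (snd (fst (gam t))))).
{ destruct (is_derive_triple _ _ _ (HG 0 ltac:(rewrite Rabs_R0; apply cond_pos))) as (D1 & D2 & _).
  apply is_derive_continuity_pt, continuity_pt_filterlim in D1.
  apply is_derive_continuity_pt, continuity_pt_filterlim in D2.
  rewrite G0 in D1, D2; simpl in D1, D2.
  generalize (filter_and _ _ (proj1 (filterlim_locally (F := locally 0) _ _) D1 e)
    (proj1 (filterlim_locally (F := locally 0) _ _) D2 e)).
  apply filter_imp; intros t [B1 B2]; apply He; [exact B1 | exact B2]. }
destruct Hloc as [e' He'].
assert (Hm : 0 < Rmin eps e') by (apply Rmin_pos; apply cond_pos).
exists (mkposreal _ Hm), gam; split; auto; simpl; intros t Ht.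
replace (lie_cartan quadratic (gam t)) with (quadratic_field (gam t)).
- replace (quadratic_field (gam t)) with (quadratic_p (fst (fst (gam t))) (snd (fst (gam t))) (snd (gam t)),
    snd (gam t) * quadratic_p (fst (fst (gam t))) (snd (fst (gam t))) (snd (gam t)),
    -1 * (quadratic_x (fst (fst (gam t))) (snd (fst (gam t))) (snd (gam t)) +
     snd (gam t) * quadratic_y (fst (fst (gam t))) (snd (fst (gam t))) (snd (gam t)))).
  + apply HG. apply Rlt_le_trans with (1 := Ht), Rmin_l.
  + unfold quadratic_field; f_equal; ring.
- assert (Hq : quadratic_partials (fst (fst (gam t))) (snd (fst (gam t)))).
  { apply He'. change (Rabs (t - 0) < e'); rewrite Rminus_0_r. apply Rlt_le_trans with (1 := Ht), Rmin_r. }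
  destruct (gam t) as [[x y] p]. symmetry; now apply lie_cartan_quadratic.
Qed.

(** * An integral curve and its derivatives *)

Section Curve.
Variables (eps : posreal) (gam : R -> R * R * R) (x0 y0 p0 : R).
Hypothesis Hgam : integral_curve quadratic eps gam.
Hypothesis Hgam0 : gam 0 = (x0, y0, p0).
Hypothesis Hpart : quadratic_partials x0 y0.

Let gx t := fst (fst (gam t)).
Let gy t := snd (fst (gam t)).
Let gp t := snd (gam t).
Let q t := quadratic_p (gx t) (gy t) (gp t).
Let p1 t := - (quadratic_x (gx t) (gy t) (gp t) + gp t * quadratic_y (gx t) (gy t) (gp t)).
(** The derivative of q along the curve by the chain rule with x' = q, y' = p q and p' = p1; thus q1
    is x''. *)
Let q1 t := 2 * ((alx (gx t) (gy t) + gp t * aly (gx t) (gy t)) * q t * gp t + al (gx t) (gy t) * p1 t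
  + (bex (gx t) (gy t) + gp t * bey (gx t) (gy t)) * q t).

Lemma curve_coordinates : gx 0 = x0 /\ gy 0 = y0 /\ gp 0 = p0.
Proof. unfold gx, gy, gp; now rewrite Hgam0. Qed.

Lemma curve_near (P : R -> R -> Prop) :
  locally_2d P x0 y0 -> locally 0 (fun t => P (gx t) (gy t)).
Proof.
intros [e He].
destruct (is_derive_triple _ _ _ (Hgam 0 ltac:(rewrite Rabs_R0; apply cond_pos))) as (D1 & D2 & _).
apply is_derive_continuity_pt, continuity_pt_filterlim in D1.
apply is_derive_continuity_pt, continuity_pt_filterlim in D2.
rewrite Hgam0 in D1, D2; simpl in D1, D2.
generalize (filter_and _ _ (proj1 (filterlim_locally (F := locally 0) _ _) D1 e)
  (proj1 (filterlim_locally (F := locally 0) _ _) D2 e)).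
apply filter_imp; intros t [B1 B2]; apply He; [exact B1 | exact B2].
Qed.

Lemma curve_derivatives : locally 0 (fun t => quadratic_partials (gx t) (gy t) /\
  is_derive gx t (q t) /\ is_derive gy t (gp t * q t) /\ is_derive gp t (p1 t)).
Proof.
assert (He : locally 0 (fun t => Rabs t < eps)).
{ exists eps; intros t Ht; change (Rabs (t - 0) < eps) in Ht; now rewrite Rminus_0_r in Ht. }
generalize (filter_and _ _ He (curve_near _ (quadratic_partials_open _ _ Hpart))).
apply filter_imp; intros t (Ht & Hq).
split; auto.
assert (HD := Hgam t Ht).
assert (E : lie_cartan quadratic (gam t) = (q t, gp t * q t, p1 t)).
{ unfold q, p1, gx, gy, gp in *; destruct (gam t) as [[x y] p].
  now apply lie_cartan_quadratic. }
rewrite E in HD; apply is_derive_triple in HD; exact HD.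
Qed.

Lemma curve_chain n f fx fy t :
  partials f fx fy (gx t) (gy t) -> smooth n fx (gx t) (gy t) ->
  is_derive gx t (q t) -> is_derive gy t (gp t * q t) ->
  is_derive (fun s => f (gx s) (gy s)) t ((fx (gx t) (gy t) + gp t * fy (gx t) (gy t)) * q t).
Proof.
intros Hf Hs Dx Dy; apply is_derive_Reals.
replace ((fx (gx t) (gy t) + gp t * fy (gx t) (gy t)) * q t) with
  (fx (gx t) (gy t) * q t + fy (gx t) (gy t) * (gp t * q t)) by ring.
apply derivable_pt_lim_comp_2d; try now apply is_derive_Reals.
now apply smooth_differentiable with n.
Qed.

Lemma curve_chain_ex f t :
  smooth 1 f (gx t) (gy t) -> is_derive gx t (q t) -> is_derive gy t (gp t * q t) ->
  ex_derive (fun s => f (gx s) (gy s)) t.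
Proof.
intros (fx & fy & Hf & Hx & Hy) Dx Dy; eexists; now apply (curve_chain 0 f fx fy).
Qed.

Lemma curve_second_derivatives : locally 0 (fun t =>
  is_derive gx t (q t) /\ is_derive gy t (gp t * q t) /\ is_derive gp t (p1 t) /\
  is_derive q t (q1 t) /\ ex_derive p1 t /\ ex_derive q1 t).
Proof.
generalize curve_derivatives; apply filter_imp; intros t (HQ & Dx & Dy & Dp).
destruct (quadratic_partials_smooth _ _ HQ) as (Sa & _ & _).
destruct HQ as (H1 & H2 & H3 & (H4 & H5) & (H6 & H7) & H8 & H9).
assert (Dq : is_derive q t (q1 t)).
{ apply (is_derive_fold (fun s => al (gx s) (gy s)) (fun s => be (gx s) (gy s)) gp); auto;
  now apply (curve_chain 1). }
assert (Ex : forall f, smooth 1 f (gx t) (gy t) -> ex_derive (fun s => f (gx s) (gy s)) t).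
{ intros f Hf; exact (curve_chain_ex f t Hf Dx Dy). }
assert (Ep : ex_derive gp t) by (eexists; exact Dp).
assert (Eq : ex_derive q t) by (eexists; exact Dq).
assert (Dp1 : ex_derive p1 t).
{ exact (ex_derive_lift_slope _ _ _ _ _ _ _ _ (Ex _ H4) (Ex _ H5) (Ex _ H6) (Ex _ H7)
    (Ex _ H8) (Ex _ H9) Ep). }
do 4 (split; [assumption|]); split; [assumption|].
exact (ex_derive_lift_speed _ _ _ _ _ _ _ _ _ (Ex _ Sa) (Ex _ H4) (Ex _ H5) (Ex _ H6) (Ex _ H7)
  Ep Eq Dp1).
Qed.

(** F is a first integral of its own Lie-Cartan field: F_x F_p + F_y p F_p - F_p (F_x + p F_y) =
    0. *)
Lemma curve_on_surface : quadratic x0 y0 p0 = 0 ->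
  locally 0 (fun t => quadratic (gx t) (gy t) (gp t) = 0).
Proof.
intros H0; destruct curve_derivatives as [e He]; exists e; intros t Ht.
destruct curve_coordinates as (X0 & Y0 & Z0).
rewrite <- H0, <- X0, <- Y0, <- Z0.
change (Rabs (t - 0) < e) in Ht; rewrite Rminus_0_r in Ht.
apply (is_derive_zero_constant (fun t => quadratic (gx t) (gy t) (gp t)) e); auto.
clear t Ht; intros t Ht.
destruct (He t) as (HQ & Dx & Dy & Dp).
{ change (Rabs (t - 0) < e); now rewrite Rminus_0_r. }
destruct HQ as (H1 & H2 & H3 & (H4 & H5) & (H6 & H7) & H8 & H9).
evar_last.
- apply (is_derive_quadratic_curve (fun s => al (gx s) (gy s)) (fun s => be (gx s) (gy s))
    (fun s => ga (gx s) (gy s)) gp); [apply (curve_chain 1) .. | exact Dp]; eassumption.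
- unfold p1, q, quadratic_x, quadratic_y, quadratic_p; ring.
Qed.

(** * Integral curves through a regular fold point *)

Section Fold.
Variables K Kx Ky : R -> R -> R.
Hypothesis HK : partials K Kx Ky x0 y0.
Hypothesis HKx : smooth 1 Kx x0 y0.
Hypothesis HKy : smooth 1 Ky x0 y0.
Hypothesis HK0 : K x0 y0 = 0.
Hypothesis Hal : 0 < al x0 y0.
Hypothesis Hroot : quadratic x0 y0 p0 = 0.
Hypothesis Hfold : quadratic_p x0 y0 p0 = 0.
Hypothesis Hsign : (quadratic_x x0 y0 p0 + p0 * quadratic_y x0 y0 p0) *
  (Kx x0 y0 + p0 * Ky x0 y0) < 0.

Lemma curve_fold_values : q 0 = 0 /\
  p1 0 = - (quadratic_x x0 y0 p0 + p0 * quadratic_y x0 y0 p0) /\ q1 0 = 2 * al x0 y0 * p1 0.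
Proof.
destruct curve_coordinates as (X0 & Y0 & Z0).
assert (Q0 : q 0 = 0) by (unfold q; now rewrite X0, Y0, Z0).
repeat split; auto.
- unfold p1; now rewrite X0, Y0, Z0.
- unfold q1; rewrite Q0, X0, Y0; ring.
Qed.

Lemma curve_cusp : cusp_tangent_to gx gy 1 p0.
Proof.
destruct curve_fold_values as (Q0 & P1 & Q1).
assert (p1 0 <> 0) by (rewrite P1; nra).
destruct curve_coordinates as (_ & _ & Z0); rewrite <- Z0.
apply cusp_of_lift with q p1 q1; auto.
- apply curve_second_derivatives.
- rewrite Q1; repeat apply Rmult_integral_contrapositive_currified; auto; lra.
Qed.

Lemma curve_K_positive : locally' 0 (fun t => 0 < K (gx t) (gy t)).
Proof.
destruct curve_fold_values as (Q0 & P1 & Q1).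
destruct curve_coordinates as (X0 & Y0 & Z0).
set (h := fun t => Kx (gx t) (gy t) + gp t * Ky (gx t) (gy t)).
apply positive_of_strict_minimum with (fun t => h t * q t).
- now rewrite X0, Y0.
- generalize (filter_and _ _ curve_derivatives (curve_near _
    (locally_2d_and _ _ _ _ (partials_open _ _ _ _ _ HK) (smooth_open _ _ _ _ HKx)))).
  apply filter_imp; intros t ((_ & Dx & Dy & _) & H1 & H2).
  now apply (curve_chain 1).
- destruct (locally_singleton _ _ curve_second_derivatives) as (Dx & Dy & Dp & Dq & _).
  assert (Dh : ex_derive h 0).
  { apply (ex_derive_plus (fun t => Kx (gx t) (gy t)) (fun t => gp t * Ky (gx t) (gy t))).
    - apply curve_chain_ex; auto; now rewrite X0, Y0.
    - apply (ex_derive_mult gp (fun t => Ky (gx t) (gy t))); [eexists; exact Dp|].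
      apply curve_chain_ex; auto; now rewrite X0, Y0. }
  apply Derive_correct in Dh.
  apply sign_of_simple_zero with (Derive h 0 * q 0 + h 0 * q1 0).
  + rewrite Q0; ring.
  + now apply Derive.is_derive_mult.
  (* The slope at 0 is h 0 * (2 al p1 0), where p1 0 is minus the first factor in [Hsign] and h 0 is
     the second one. *)
  + unfold h at 2; rewrite Q0, Q1, P1, X0, Y0, Z0. nra.
Qed.

Lemma curve_speed_sign :
  (locally' 0 (fun t => 0 < t * q t)) \/ (locally' 0 (fun t => t * q t < 0)).
Proof.
destruct curve_fold_values as (Q0 & P1 & Q1).
destruct (locally_singleton _ _ curve_second_derivatives) as (_ & _ & _ & Dq & _).
assert (Hq1 : q1 0 <> 0).
{ rewrite Q1; repeat apply Rmult_integral_contrapositive_currified; try lra. rewrite P1; nra. }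
destruct (Rtotal_order 0 (q1 0)) as [H|[H|H]]; [left| lra |right].
- now apply sign_of_simple_zero with (q1 0).
- assert (H' : locally' 0 (fun t => 0 < t * (- q t))).
  { apply sign_of_simple_zero with (- q1 0); [rewrite Q0; ring | | lra].
    now apply (is_derive_opp q). }
  revert H'; apply filter_imp; intros; lra.
Qed.

Lemma curve_foliations :
  (at_left 0 (fun t => on_first_foliation quadratic (gam t)) /\
   at_right 0 (fun t => on_second_foliation quadratic (gam t))) \/
  (at_left 0 (fun t => on_second_foliation quadratic (gam t)) /\
   at_right 0 (fun t => on_first_foliation quadratic (gam t))).
Proof.
assert (Hpos : locally_2d (fun x y => 0 < al x y) x0 y0).
{ apply continuity_2d_pt_pos; auto.
  apply (smooth_continuous 1), (quadratic_partials_smooth _ _ Hpart). }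
assert (Hboth : locally 0 (fun t =>
  (q t < 0 -> on_first_foliation quadratic (gam t)) /\
  (0 < q t -> on_second_foliation quadratic (gam t)))).
{ generalize (filter_and _ _ (curve_on_surface Hroot) (curve_near _ Hpos)).
  apply filter_imp; intros t (H0 & Ha).
  (* The roots sum to -2 be / al and q = 2 (al p + be), so p - q / al is the other root. The sign of
     q tells which root the curve carries. *)
  assert (Hr : quadratic (gx t) (gy t) (gp t - q t / al (gx t) (gy t)) = 0).
  { transitivity (quadratic (gx t) (gy t) (gp t)); auto.
    unfold quadratic, q, quadratic_p; field; lra. }
  assert (Hi : 0 < / al (gx t) (gy t)) by now apply Rinv_0_lt_compat.
  split; intros Hq; (split; [exact H0|]); exists (gp t - q t / al (gx t) (gy t)); (split; [|exact Hr]);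
  change (snd (gam t)) with (gp t); unfold Rdiv; nra. }
assert (HL : forall P : R -> Prop, locally' 0 P -> at_left 0 P).
{ intros P [e He]; exists e; intros t Ht Hlt; apply He; auto; lra. }
assert (HR : forall P : R -> Prop, locally' 0 P -> at_right 0 P).
{ intros P [e He]; exists e; intros t Ht Hlt; apply He; auto; lra. }
destruct Hboth as [e He].
destruct curve_speed_sign as [[e' He']|[e' He']]; [left|right];
(assert (Hm : 0 < Rmin e e') by (apply Rmin_pos; apply cond_pos));
(split; exists (mkposreal _ Hm); intros t Ht Hlt;
 [assert (B1 : ball 0 e t) by (apply Rlt_le_trans with (1 := Ht), Rmin_l);
  assert (B2 : ball 0 e' t) by (apply Rlt_le_trans with (1 := Ht), Rmin_r);
  specialize (He t B1); specialize (He' t B2 ltac:(lra)); apply He; nra ..]).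
Qed.
End Fold.
End Curve.
End Quadratic.

(** * Folded singularities *)


(** Restates over R an equality whose type is the carrier of a normed module, so that [ring]
    recognises it. *)
Ltac real_ring :=
  match goal with |- @eq _ ?a ?b => apply (Rminus_diag_uniq a b); ring end.

(** The differential is recorded by its three coefficients, which reduces the sum and product rules
    to arithmetic on numbers. *)
Definition grad3 (f : R * R * R -> R) (P : R * R * R) (a b c : R) : Prop :=
  filterdiff (U := R3) (V := R_NormedModule) f (locally (T := R3) P)
    (fun u => a * fst (fst u) + b * snd (fst u) + c * snd u).

Lemma grad3_eq f P a b c a' b' c' :
  grad3 f P a b c -> a = a' -> b = b' -> c = c' -> grad3 f P a' b' c'.
Proof. now intros H -> -> ->. Qed.

Lemma grad3_base (f fx fy : R -> R -> R) (P : R * R * R) :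
  partials f fx fy (fst (fst P)) (snd (fst P)) -> smooth 0 fx (fst (fst P)) (snd (fst P)) ->
  grad3 (fun Q => f (fst (fst Q)) (snd (fst Q))) P
    (fx (fst (fst P)) (snd (fst P))) (fy (fst (fst P)) (snd (fst P))) 0.
Proof.
destruct P as [[x y] p]; simpl fst; simpl snd; intros Hf Hx.
apply smooth_differentiable with (2 := Hx) in Hf.
apply filterdiff_differentiable_pt_lim in Hf.
assert (Hl : filterdiff (U := R3) fst (locally (T := R3) (x, y, p)) fst)
  by apply filterdiff_linear, is_linear_fst.
assert (H := filterdiff_comp' (U := R3) fst (fun u => f (fst u) (snd u)) (x, y, p) _ _ Hl Hf).
apply filterdiff_ext_lin with (1 := H); intros [[u v] w]; simpl; real_ring.
Qed.

Lemma grad3_snd P : grad3 snd P 0 0 1.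
Proof.
assert (Hl : filterdiff (U := R3) snd (locally (T := R3) P) snd)
  by apply filterdiff_linear, is_linear_snd.
apply filterdiff_ext_lin with (1 := Hl); intros [[u v] w]; simpl; real_ring.
Qed.

Lemma grad3_const k P : grad3 (fun _ => k) P 0 0 0.
Proof.
apply filterdiff_ext_lin with (fun _ => 0); [apply (filterdiff_const (U := R3) (V := R_NormedModule))|].
intros [[u v] w]; simpl; real_ring.
Qed.

Lemma grad3_plus f g P a b c a' b' c' : grad3 f P a b c -> grad3 g P a' b' c' ->
  grad3 (fun Q => f Q + g Q) P (a + a') (b + b') (c + c').
Proof.
intros Hf Hg.
apply (filterdiff_ext_lin (U := R3) (V := R_NormedModule)) with (1 := filterdiff_plus_fct (U := R3) (V := R_NormedModule) _ _ _ _ Hf Hg).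
intros [[u v] w]; unfold plus; simpl; real_ring.
Qed.

Lemma grad3_mult f g P a b c a' b' c' : grad3 f P a b c -> grad3 g P a' b' c' ->
  grad3 (fun Q => f Q * g Q) P (a * g P + f P * a') (b * g P + f P * b') (c * g P + f P * c').
Proof.
intros Hf Hg.
apply (filterdiff_ext_lin (U := R3) (V := R_NormedModule))
  with (1 := filterdiff_mult_fct (K := R_AbsRing) (U := R3) f g P _ _ Rmult_comm Hf Hg).
intros [[u v] w]; unfold plus, mult; simpl; real_ring.
Qed.

Lemma filterdiff_pair {T U V : NormedModule R_AbsRing} (f : T -> U) (g : T -> V) (x : T) lf lg :
  filterdiff f (locally x) lf -> filterdiff g (locally x) lg ->
  filterdiff (V := prod_NormedModule _ U V) (fun t => (f t, g t)) (locally x) (fun t => (lf t, lg t)).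
Proof.
intros Hf Hg.
apply (filterdiff_comp'_2 (W := prod_NormedModule _ U V) f g (fun a b => (a, b)) x lf lg (fun a b => (a, b)) Hf Hg).
apply (filterdiff_ext (U := prod_NormedModule _ U V) (V := prod_NormedModule _ U V) (fun t => t)).
{ now intros [a b]. }
apply filterdiff_ext_lin with (fun t => t); [apply filterdiff_id|].
now intros [a b].
Qed.

Section Folded.
Variables al be ga alx aly bex bey gax gay gaxx gaxy : R -> R -> R.
Variables x0 y0 : R.
Let F := quadratic al be ga.
Hypothesis Hpart : quadratic_partials al be ga alx aly bex bey gax gay x0 y0.
Hypothesis Hgax : partials gax gaxx gaxy x0 y0.
Hypothesis Hgaxx : smooth 0 gaxx x0 y0.
Hypothesis Hal : al x0 y0 <> 0.
Hypothesis Hbe : be x0 y0 = 0.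
Hypothesis Hga : ga x0 y0 = 0.
Hypothesis Hgax0 : gax x0 y0 = 0.
Hypothesis Hgay0 : gay x0 y0 <> 0.

Let P0 := (x0, y0, 0).

Lemma grad3_quadratic_coef a b c ax ay bx bY cx cy :
  partials a ax ay x0 y0 -> partials b bx bY x0 y0 -> partials c cx cy x0 y0 ->
  smooth 0 ax x0 y0 -> smooth 0 bx x0 y0 -> smooth 0 cx x0 y0 ->
  grad3 (fun P => quadratic a b c (fst (fst P)) (snd (fst P)) (snd P)) P0
   (cx x0 y0) (cy x0 y0) (2 * b x0 y0).
Proof.
intros Ha Hb Hc Sa Sb Sc.
assert (Ga := grad3_base a ax ay P0 Ha Sa). assert (Gb := grad3_base b bx bY P0 Hb Sb).
assert (Gc := grad3_base c cx cy P0 Hc Sc). assert (Gp := grad3_snd P0).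
assert (G := grad3_plus _ _ _ _ _ _ _ _ _ (grad3_plus _ _ _ _ _ _ _ _ _
  (grad3_mult _ _ _ _ _ _ _ _ _ Ga (grad3_mult _ _ _ _ _ _ _ _ _ Gp (grad3_mult _ _ _ _ _ _ _ _ _ Gp (grad3_const 1 _))))
  (grad3_mult _ _ _ _ _ _ _ _ _ (grad3_mult _ _ _ _ _ _ _ _ _ (grad3_const 2 _) Gb) Gp)) Gc).
apply grad3_eq with (1 := G); simpl; ring.
Qed.

Lemma lie_cartan_fold_zero : lie_cartan F P0 = (0, 0, 0).
Proof.
unfold F, P0; rewrite lie_cartan_quadratic with (1 := Hpart).
unfold quadratic_field, quadratic_p, quadratic_x, quadratic_y; simpl.
rewrite Hbe, Hgax0; repeat (f_equal; try ring).
Qed.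

(** The Jacobian where p = F_p = 0. The second row vanishes because y' = p F_p is a product of two
    zeros; in the last row the derivative of p F_y along p contributes F_y itself. *)
Let L (u : R * R * R) : R * R * R :=
  (2 * bex x0 y0 * fst (fst u) + 2 * bey x0 y0 * snd (fst u) + 2 * al x0 y0 * snd u,
   0,
   - gaxx x0 y0 * fst (fst u) + - gaxy x0 y0 * snd (fst u)
     + - (2 * bex x0 y0 + gay x0 y0) * snd u).

Lemma lie_cartan_fold_differential :
  filterdiff (U := R3) (V := R3) (lie_cartan F) (locally (T := R3) P0) L.
Proof.
assert (Hs := Hpart).
destruct (quadratic_partials_smooth _ _ _ _ _ _ _ _ _ _ _ Hs) as (Sa & Sb & Sg).
destruct Hs as (H1 & H2 & H3 & (H4 & H5) & (H6 & H7) & H8 & H9).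
apply (filterdiff_ext_locally (U := R3) (V := R3)
  (fun P => quadratic_field al be alx aly bex bey gax gay P)).
{ destruct (quadratic_partials_open _ _ _ _ _ _ _ _ _ _ _ Hpart) as [e He].
  exists e; intros [[x y] p] [[B1 B2] B3]; symmetry; apply lie_cartan_quadratic; now apply He. }
assert (Gp := grad3_snd P0).
assert (Gq : grad3 (fun P => quadratic_p al be (fst (fst P)) (snd (fst P)) (snd P)) P0
  (2 * bex x0 y0) (2 * bey x0 y0) (2 * al x0 y0)).
{ assert (Ga := grad3_base al alx aly P0 H1 (smooth_pred _ _ _ _ H4)).
  assert (Gb := grad3_base be bex bey P0 H2 (smooth_pred _ _ _ _ H6)).
  assert (G := grad3_mult _ _ _ _ _ _ _ _ _ (grad3_const 2 _) (grad3_plus _ _ _ _ _ _ _ _ _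
    (grad3_mult _ _ _ _ _ _ _ _ _ Ga Gp) Gb)).
  apply grad3_eq with (1 := G); simpl; ring. }
assert (Gx : grad3 (fun P => quadratic_x alx bex gax (fst (fst P)) (snd (fst P)) (snd P)) P0
  (gaxx x0 y0) (gaxy x0 y0) (2 * bex x0 y0)).
{ destruct H4 as (a1 & a2 & A & A1 & A2), H6 as (b1 & b2 & B & B1 & B2).
  now apply (grad3_quadratic_coef alx bex gax a1 a2 b1 b2 gaxx gaxy). }
(* F_y enters the field only in p F_y with p = 0 at P0, so its own gradient drops out of the
   Jacobian and bare existence suffices. *)
assert (Gy : exists c1 c2, grad3 (fun P => quadratic_y aly bey gay (fst (fst P)) (snd (fst P)) (snd P)) P0
  c1 c2 (2 * bey x0 y0)).
{ destruct H5 as (a1 & a2 & A & A1 & A2), H7 as (b1 & b2 & B & B1 & B2), H9 as (c1 & c2 & C & C1 & C2).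
  exists (c1 x0 y0), (c2 x0 y0).
  now apply (grad3_quadratic_coef aly bey gay a1 a2 b1 b2 c1 c2). }
destruct Gy as (c1 & c2 & Gy).
assert (G2 := grad3_mult _ _ _ _ _ _ _ _ _ Gp Gq).
assert (G3 := grad3_mult _ _ _ _ _ _ _ _ _ (grad3_const (-1) P0)
  (grad3_plus _ _ _ _ _ _ _ _ _ Gx (grad3_mult _ _ _ _ _ _ _ _ _ Gp Gy))).
assert (G := filterdiff_pair _ _ _ _ _ (filterdiff_pair _ _ _ _ _ Gq G2) G3).
eapply (filterdiff_ext_lin (U := R3) (V := R3)).
- eapply (filterdiff_ext (U := R3) (V := R3)); [|exact G].
  intros [[x y] p]; unfold quadratic_field; simpl; f_equal; real_ring.
- intros [[u v] w]; unfold L; simpl; f_equal; [f_equal|].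
  + unfold quadratic_p; rewrite Hbe; real_ring.
  + unfold quadratic_y; real_ring.
Qed.

Lemma quadratic_fold_differential :
  filterdiff (U := R3) (V := R_NormedModule) (eval3 F) (locally (T := R3) P0)
    (fun u => gay x0 y0 * snd (fst u)).
Proof.
destruct Hpart as (H1 & H2 & H3 & (H4 & H5) & (H6 & H7) & H8 & H9).
assert (G := grad3_quadratic_coef al be ga alx aly bex bey gax gay H1 H2 H3
  (smooth_pred _ _ _ _ H4) (smooth_pred _ _ _ _ H6) (smooth_pred _ _ _ _ H8)).
apply (filterdiff_ext_lin (U := R3) (V := R_NormedModule)) with (1 := G).
intros [[u v] w]; simpl; rewrite Hgax0, Hbe; ring.
Qed.

(** [tr] and [det] belong to the 2 by 2 block of [L] in the x and p coordinates; the terms 2 bex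
    cancel in the trace. *)
Let tr := - gay x0 y0.
Let det := 2 * al x0 y0 * gaxx x0 y0 - 2 * bex x0 y0 * (2 * bex x0 y0 + gay x0 y0).

Lemma quadratic_folded_hyperbolic (l1 l2 : C) :
  Cplus l1 l2 = RtoC tr -> Cmult l1 l2 = RtoC det -> Re l1 <> 0 -> Re l2 <> 0 ->
  folded_hyperbolic F x0 y0 l1 l2.
Proof.
intros Htr Hdet Hl1 Hl2; exists 0; repeat split; auto.
- unfold F, quadratic; rewrite Hbe, Hga; intros H.
  assert (al x0 y0 * p ^ 2 = 0) by lra.
  destruct (Req_dec p 0) as [|Hp]; auto; exfalso.
  revert H0; apply Rmult_integral_contrapositive_currified; auto; now apply pow_nonzero.
- intros ->; unfold F, quadratic; rewrite Hbe, Hga; ring.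
- unfold F; rewrite F_p_quadratic; unfold quadratic_p; rewrite Hbe; ring.
- change (Derive (F_p F x0 y0) 0 <> 0).
  rewrite (Derive_ext _ (fun p => 2 * (al x0 y0 * p + be x0 y0))) by (intros; apply F_p_quadratic).
  replace (Derive _ _) with (2 * al x0 y0); [lra|].
  symmetry; apply is_derive_unique; auto_derive; auto; ring.
- apply lie_cartan_fold_zero.
- exists (fun u => gay x0 y0 * snd (fst u)), L; split; [|split; [|split]].
  + apply quadratic_fold_differential.
  + exists (0, 1, 0); simpl; lra.
  + apply lie_cartan_fold_differential.
  + exists (1, 0, 0), (0, 0, 1), (2 * bex x0 y0), (2 * al x0 y0), (- gaxx x0 y0),
      (- (2 * bex x0 y0 + gay x0 y0)).
    split; [simpl; ring|]. split; [simpl; ring|]. split; [|split; [|split; [|split]]].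
    * intros s t E.
      assert (E1 := f_equal (fun u : R * R * R => fst (fst u)) E).
      assert (E2 := f_equal (fun u : R * R * R => snd u) E).
      change (s * 1 + t * 0 = 0) in E1; change (s * 0 + t * 1 = 0) in E2; lra.
    * unfold L; apply injective_projections; [apply injective_projections|];
      unfold plus, scal; simpl; unfold plus, scal; simpl; unfold mult; simpl; ring.
    * unfold L; apply injective_projections; [apply injective_projections|];
      unfold plus, scal; simpl; unfold plus, scal; simpl; unfold mult; simpl; ring.
    * rewrite Htr; f_equal; unfold tr; ring.
    * rewrite Hdet; f_equal; unfold det; ring.
Qed.

Lemma quadratic_folded_saddle : det < 0 -> folded_saddle F x0 y0.
Proof.
intros Hd.
assert (HD : 0 < tr ^ 2 - 4 * det) by (generalize (pow2_ge_0 tr); lra).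
set (s := sqrt (tr ^ 2 - 4 * det)).
assert (Hs : s ^ 2 = tr ^ 2 - 4 * det) by (apply pow2_sqrt; lra).
assert (Hp : (tr + s) / 2 * ((tr - s) / 2) = det) by (simpl in *; lra).
exists (RtoC ((tr + s) / 2)), (RtoC ((tr - s) / 2)); simpl; repeat split; [|lra].
apply quadratic_folded_hyperbolic.
- rewrite <- RtoC_plus; f_equal; field.
- now rewrite <- RtoC_mult, Hp.
- simpl; intros E; rewrite E in Hp; lra.
- simpl; intros E; rewrite E in Hp; lra.
Qed.

Lemma quadratic_folded_node : 0 < det -> 0 < tr ^ 2 - 4 * det -> folded_node F x0 y0.
Proof.
intros Hd HD.
assert (Hs0 := sqrt_lt_R0 _ HD).
set (s := sqrt (tr ^ 2 - 4 * det)) in *.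
assert (Hs : s ^ 2 = tr ^ 2 - 4 * det) by (apply pow2_sqrt; lra).
assert (Hp : (tr + s) / 2 * ((tr - s) / 2) = det) by (simpl in *; lra).
exists (RtoC ((tr + s) / 2)), (RtoC ((tr - s) / 2)); simpl; repeat split; [|lra|].
- apply quadratic_folded_hyperbolic.
  + rewrite <- RtoC_plus; f_equal; field.
  + now rewrite <- RtoC_mult, Hp.
  + simpl; intros E; rewrite E in Hp; lra.
  + simpl; intros E; rewrite E in Hp; lra.
- intros E; injection E; lra.
Qed.

Lemma quadratic_folded_focus : tr ^ 2 - 4 * det < 0 -> folded_focus F x0 y0.
Proof.
intros HD.
assert (HD' : 0 < 4 * det - tr ^ 2) by lra.
assert (Hs0 := sqrt_lt_R0 _ HD').
set (s := sqrt (4 * det - tr ^ 2)) in *.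
assert (Hs : s ^ 2 = 4 * det - tr ^ 2) by (apply pow2_sqrt; lra).
exists (tr / 2, s / 2), (tr / 2, - s / 2); simpl; repeat split; try lra.
(* The common real part tr / 2 = - gay / 2 is nonzero by [Hgay0]. *)
apply quadratic_folded_hyperbolic; simpl; try (unfold tr; lra).
- unfold Cplus, RtoC; simpl; f_equal; field.
- unfold Cmult, RtoC; simpl; f_equal; simpl in Hs; lra.
Qed.
End Folded.

(** * Leading terms of the coefficients *)


(* With A = z_xx and B = D = z_xy this applies to K and to e - M E;
   with A = z_xy, B = z_x and D = z_y, to f - M F. *)
Lemma partials_leading_part (A Ax Ay Axx Axy B Bx By D Dx Dy g h : R -> R -> R) (x y : R) :
  partials A Ax Ay x y -> partials Ax Axx Axy x y -> smooth 1 Axx x y -> smooth 1 Axy x y ->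
  smooth 1 Ay x y ->
  partials B Bx By x y -> smooth 2 Bx x y -> smooth 2 By x y ->
  partials D Dx Dy x y -> smooth 2 Dx x y -> smooth 2 Dy x y ->
  smooth 2 g x y -> smooth 2 h x y ->
  A x y = 0 -> B x y = 0 -> D x y = 0 ->
  exists fx fy fxx fxy,
    partials (fun u v => A u v * g u v + B u v * D u v * h u v) fx fy x y /\
    smooth 1 fx x y /\ smooth 1 fy x y /\
    fx x y = Ax x y * g x y /\ fy x y = Ay x y * g x y /\
    partials fx fxx fxy x y /\ smooth 0 fxx x y /\
    (Ax x y = 0 -> fxx x y = Axx x y * g x y + 2 * Bx x y * Dx x y * h x y).
Proof.
intros HA HAx SAxx SAxy SAy HB SBx SBy HD SDx SDy Sg Sh A0 B0 D0.
assert (SAx : smooth 1 Ax x y) by (exists Axx, Axy; repeat split; auto; now apply smooth_pred).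
assert (SA : smooth 1 A x y) by (exists Ax, Ay; repeat split; auto; now apply smooth_pred).
assert (SB : smooth 1 B x y) by (exists Bx, By; repeat split; auto; now apply (smooth_le 2 0); auto).
assert (SD : smooth 1 D x y) by (exists Dx, Dy; repeat split; auto; now apply (smooth_le 2 0); auto).
assert (SBx' := smooth_pred _ _ _ _ SBx). assert (SBy' := smooth_pred _ _ _ _ SBy).
assert (SDx' := smooth_pred _ _ _ _ SDx). assert (SDy' := smooth_pred _ _ _ _ SDy).
assert (Sg' := smooth_pred _ _ _ _ Sg). assert (Sh' := smooth_pred _ _ _ _ Sh).
destruct Sg as (gx & gy & Hg & Sgx & Sgy). destruct Sh as (hx & hy & Hh & Shx & Shy).
assert (Hf := partials_plus _ _ _ _ _ _ _ _ (partials_mult _ _ _ _ _ _ _ _ HA Hg)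
  (partials_mult _ _ _ _ _ _ _ _ (partials_mult _ _ _ _ _ _ _ _ HB HD) Hh)).
cbv beta in Hf.
assert (Sgx' := Sgx); destruct Sgx' as (gxx & gxy & Hgx & Sgxx & Sgxy).
assert (Shx' := Shx); destruct Shx' as (hxx & hxy & Hhx & Shxx & Shxy).
assert (SBx'' := SBx'); destruct SBx'' as (Bxx & Bxy & HBx & SBxx & SBxy).
assert (SDx'' := SDx'); destruct SDx'' as (Dxx & Dxy & HDx & SDxx & SDxy).
assert (Hfx := partials_plus _ _ _ _ _ _ _ _
  (partials_plus _ _ _ _ _ _ _ _ (partials_mult _ _ _ _ _ _ _ _ HAx Hg) (partials_mult _ _ _ _ _ _ _ _ HA Hgx))
  (partials_plus _ _ _ _ _ _ _ _
    (partials_mult _ _ _ _ _ _ _ _ (partials_plus _ _ _ _ _ _ _ _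
       (partials_mult _ _ _ _ _ _ _ _ HBx HD) (partials_mult _ _ _ _ _ _ _ _ HB HDx)) Hh)
    (partials_mult _ _ _ _ _ _ _ _ (partials_mult _ _ _ _ _ _ _ _ HB HD) Hhx))).
cbv beta in Hfx.
eexists; eexists; eexists; eexists; split; [exact Hf|].
split; [|split; [|split; [|split; [|split; [exact Hfx|split]]]]].
- repeat (apply smooth_plus || apply smooth_mult); assumption.
- repeat (apply smooth_plus || apply smooth_mult); assumption.
- rewrite A0, B0, D0; ring.
- rewrite A0, B0, D0; ring.
- repeat (apply smooth_plus || apply smooth_mult); (assumption || (now apply smooth_pred)).
(* A vanishing [Ax] removes the cross term 2 Ax gx, the only place where a derivative of g would
   survive. *)
- intros Ax0; rewrite A0, B0, D0, Ax0; ring.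
Qed.

(** * Values and derivatives at the origin of K and of the coefficients of F *)

Section Jet.
Variables z mu : R -> R -> R.
Hypothesis Hz : class_C 6 z.
Hypothesis Hmu : smooth 2 mu 0 0.

Lemma smooth_partial_derive n p q :
  (p + q + n <= 6)%nat -> smooth n (partial_derive p q z) 0 0.
Proof.
intros Hn; apply smooth_le with (6 - (p + q))%nat; [lia|].
apply class_C_smooth, class_C_partial_derive; auto; lia.
Qed.

(** [partial_derive] takes the y-derivatives first, so the x-partial is immediate, while the
    y-partial requires the derivatives to commute and thus differentiability on a neighbourhood. *)
Lemma partials_partial_derive p q : (p + q < 6)%nat ->
  partials (partial_derive p q z) (partial_derive (S p) q z) (partial_derive p (S q) z) 0 0.
Proof.
intros Hpq; generalize (locally_2d_and _ _ _ _ Hz (locally_2d_open _ _ _ Hz)).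
apply locally_2d_imp; intros x y (H & H'); split.
- apply (Derive_correct (fun t => partial_derive p q z t y)).
  now apply ex_diff_n_ex_deriv_inf_1 with 6%nat.
- rewrite <- Derive_partial_derive.
  + apply (Derive_correct (fun t => partial_derive p q z x t)).
    now apply ex_diff_n_ex_deriv_inf_2 with 6%nat.
  + revert H'; apply locally_2d_imp; intros u v; apply ex_diff_n_m; lia.
Qed.

Lemma smooth_I_E : smooth 2 (I_E z) 0 0.
Proof.
apply smooth_plus; [apply smooth_const|].
apply (smooth_pow 2 (partial_derive 1 0 z)), smooth_partial_derive; lia.
Qed.

Lemma smooth_I_G : smooth 2 (I_G z) 0 0.
Proof.
apply smooth_plus; [apply smooth_const|].
apply (smooth_pow 2 (partial_derive 0 1 z)), smooth_partial_derive; lia.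
Qed.

Lemma smooth_area2 : smooth 2 (area2 z) 0 0.
Proof.
apply smooth_plus; [apply smooth_I_E|].
apply (smooth_pow 2 (partial_derive 0 1 z)), smooth_partial_derive; lia.
Qed.

Lemma smooth_inv_area2_sqr : smooth 2 (fun x y => / area2 z x y ^ 2) 0 0.
Proof.
apply (smooth_inv 2 (fun x y => area2 z x y ^ 2)).
- apply smooth_pow, smooth_area2.
- generalize (area2_pos z 0 0); intros; apply pow_nonzero; lra.
Qed.

Lemma smooth_inv_area_W : smooth 2 (fun x y => / area_W z x y) 0 0.
Proof.
apply (smooth_inv 2 (area_W z)).
- apply (smooth_sqrt 2 (area2 z)); [apply smooth_area2 | apply area2_pos].
- generalize (area_W_pos z 0 0); lra.
Qed.

Lemma smooth_gauss_K : smooth 2 (gauss_K z) 0 0.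
Proof.
apply (smooth_ext 2 (fun x y => hessian_det z x y * / area2 z x y ^ 2)).
{ intros; now rewrite gauss_K_hessian. }
apply smooth_mult; [|apply smooth_inv_area2_sqr].
apply smooth_minus.
- apply smooth_mult; apply smooth_partial_derive; lia.
- apply smooth_pow, smooth_partial_derive; lia.
Qed.

Hypothesis Hz10 : partial_derive 1 0 z 0 0 = 0.
Hypothesis Hz01 : partial_derive 0 1 z 0 0 = 0.
Hypothesis Hz20 : partial_derive 2 0 z 0 0 = 0.
Hypothesis Hz11 : partial_derive 1 1 z 0 0 = 0.

Let k := partial_derive 0 2 z 0 0.
Let a := partial_derive 3 0 z 0 0.
Let d := partial_derive 2 1 z 0 0.
Let A := partial_derive 4 0 z 0 0.
Let m0 := mu 0 0.
Let M x y := mu x y * gauss_K z x y.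
Let al x y := II_g z x y - M x y * I_G z x y.
Let be x y := II_f z x y - M x y * I_F z x y.
Let ga x y := II_e z x y - M x y * I_E z x y.

Lemma area2_origin : area2 z 0 0 = 1.
Proof. unfold area2, z_x, z_y; rewrite Hz10, Hz01; ring. Qed.

Lemma area_W_origin : area_W z 0 0 = 1.
Proof. unfold area_W; fold (area2 z 0 0); rewrite area2_origin; apply sqrt_1. Qed.

Lemma gauss_K_origin : gauss_K z 0 0 = 0.
Proof.
rewrite gauss_K_hessian, area2_origin; unfold hessian_det; rewrite Hz20, Hz11; field.
Qed.

Lemma gauss_K_leading : exists Kx Ky,
  partials (gauss_K z) Kx Ky 0 0 /\ smooth 1 Kx 0 0 /\ smooth 1 Ky 0 0 /\ Kx 0 0 = a * k.
Proof.
destruct (partials_leading_part _ _ _ _ _ _ _ _ _ _ _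
  (fun x y => partial_derive 0 2 z x y * / area2 z x y ^ 2) (fun x y => - / area2 z x y ^ 2) 0 0
  (partials_partial_derive 2 0 ltac:(lia)) (partials_partial_derive 3 0 ltac:(lia))
  (smooth_partial_derive 1 4 0 ltac:(lia)) (smooth_partial_derive 1 3 1 ltac:(lia))
  (smooth_partial_derive 1 2 1 ltac:(lia))
  (partials_partial_derive 1 1 ltac:(lia)) (smooth_partial_derive 2 2 1 ltac:(lia))
  (smooth_partial_derive 2 1 2 ltac:(lia))
  (partials_partial_derive 1 1 ltac:(lia)) (smooth_partial_derive 2 2 1 ltac:(lia))
  (smooth_partial_derive 2 1 2 ltac:(lia))) as (Kx & Ky & Kxx & Kxy & HK & SKx & SKy & Ex & Ey & _); auto.
- apply smooth_mult; [apply smooth_partial_derive; lia | apply smooth_inv_area2_sqr].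
- apply (smooth_opp 2 (fun x y => / area2 z x y ^ 2)), smooth_inv_area2_sqr.
- exists Kx, Ky; split; [|split; [|split]]; auto.
  + apply partials_ext_loc with (2 := HK), locally_2d_forall; intros x y.
    rewrite gauss_K_hessian; unfold hessian_det; field; apply Rgt_not_eq, area2_pos.
  + rewrite Ex, area2_origin; unfold a, k; field.
Qed.

Lemma coefficient_al_leading : al 0 0 = k /\ smooth 2 al 0 0.
Proof.
split.
- unfold al, M; rewrite gauss_K_origin; unfold II_g; rewrite area_W_origin; unfold k; field.
- apply smooth_minus.
  + apply smooth_mult; [apply smooth_partial_derive; lia | apply smooth_inv_area_W].
  + apply smooth_mult; [apply smooth_mult; auto; apply smooth_gauss_K | apply smooth_I_G].
Qed.

Lemma coefficient_be_leading : be 0 0 = 0 /\ exists bex bey,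
  partials be bex bey 0 0 /\ smooth 1 bex 0 0 /\ smooth 1 bey 0 0 /\ bex 0 0 = d.
Proof.
split.
{ unfold be, M; rewrite gauss_K_origin; unfold II_f; rewrite Hz11; field; apply Rgt_not_eq, area_W_pos. }
destruct (partials_leading_part _ _ _ _ _ _ _ _ _ _ _
  (fun x y => / area_W z x y) (fun x y => - M x y) 0 0
  (partials_partial_derive 1 1 ltac:(lia)) (partials_partial_derive 2 1 ltac:(lia))
  (smooth_partial_derive 1 3 1 ltac:(lia)) (smooth_partial_derive 1 2 2 ltac:(lia))
  (smooth_partial_derive 1 1 2 ltac:(lia))
  (partials_partial_derive 1 0 ltac:(lia)) (smooth_partial_derive 2 2 0 ltac:(lia))
  (smooth_partial_derive 2 1 1 ltac:(lia))
  (partials_partial_derive 0 1 ltac:(lia)) (smooth_partial_derive 2 1 1 ltac:(lia))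
  (smooth_partial_derive 2 0 2 ltac:(lia)) smooth_inv_area_W)
  as (bex & bey & bexx & bexy & Hb & Sbx & Sby & Ex & _); auto.
- apply smooth_opp, smooth_mult; auto; apply smooth_gauss_K.
- exists bex, bey; split; [|split; [|split]]; auto.
  + apply partials_ext_loc with (2 := Hb), locally_2d_forall; intros x y.
    unfold be, II_f, I_F, z_x, z_y, Rdiv; ring.
  + rewrite Ex, area_W_origin; unfold d; field.
Qed.

(** Collecting z_xx in e - M E leaves the factor 1 / W - mu E z_yy / W^4, which is 1 - m0 k at the
    origin; this is the common factor of both first derivatives. The remaining term is z_xy^2 times
    a function equal to m0 there: it has a double zero and yields 2 d^2 m0 in the second
    derivative. *)
Lemma coefficient_ga_leading : ga 0 0 = 0 /\ exists gax gay gaxx gaxy,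
  partials ga gax gay 0 0 /\ smooth 1 gax 0 0 /\ smooth 1 gay 0 0 /\
  gax 0 0 = a * (1 - m0 * k) /\ gay 0 0 = d * (1 - m0 * k) /\
  partials gax gaxx gaxy 0 0 /\ smooth 0 gaxx 0 0 /\
  (a = 0 -> gaxx 0 0 = A * (1 - m0 * k) + 2 * d ^ 2 * m0).
Proof.
assert (HE : I_E z 0 0 = 1) by (unfold I_E, z_x; rewrite Hz10; ring).
split.
{ unfold ga, M; rewrite gauss_K_origin; unfold II_e; rewrite Hz20; field; apply Rgt_not_eq, area_W_pos. }
assert (Sc : smooth 2 (fun x y => mu x y * I_E z x y * / area2 z x y ^ 2) 0 0).
{ apply smooth_mult; [|apply smooth_inv_area2_sqr].
  apply smooth_mult; auto; apply smooth_I_E. }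
destruct (partials_leading_part _ _ _ _ _ _ _ _ _ _ _
  (fun x y => / area_W z x y - mu x y * I_E z x y * / area2 z x y ^ 2 * partial_derive 0 2 z x y)
  (fun x y => mu x y * I_E z x y * / area2 z x y ^ 2) 0 0
  (partials_partial_derive 2 0 ltac:(lia)) (partials_partial_derive 3 0 ltac:(lia))
  (smooth_partial_derive 1 4 0 ltac:(lia)) (smooth_partial_derive 1 3 1 ltac:(lia))
  (smooth_partial_derive 1 2 1 ltac:(lia))
  (partials_partial_derive 1 1 ltac:(lia)) (smooth_partial_derive 2 2 1 ltac:(lia))
  (smooth_partial_derive 2 1 2 ltac:(lia))
  (partials_partial_derive 1 1 ltac:(lia)) (smooth_partial_derive 2 2 1 ltac:(lia))
  (smooth_partial_derive 2 1 2 ltac:(lia))) as (gax & gay & gaxx & gaxy & H1 & H2 & H3 & Ex & Ey & H4 & H5 & Exx); auto.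
- apply smooth_minus; [apply smooth_inv_area_W|].
  apply smooth_mult; auto; apply smooth_partial_derive; lia.
- exists gax, gay, gaxx, gaxy; split; [|split; [|split; [|split; [|split; [|split; [|split]]]]]]; auto.
  + apply partials_ext_loc with (2 := H1), locally_2d_forall; intros x y.
    unfold ga, M; rewrite gauss_K_hessian; unfold hessian_det, II_e, Rdiv; ring.
  + rewrite Ex, area_W_origin, area2_origin, HE; unfold a, m0, k; field.
  + rewrite Ey, area_W_origin, area2_origin, HE; unfold d, m0, k; field.
  + intros Ha; rewrite (Exx Ha), area_W_origin, area2_origin, HE; unfold A, d, m0, k; field.
Qed.

Lemma coefficient_partials :
  exists alx aly bex bey gax gay gaxx gaxy,
    quadratic_partials al be ga alx aly bex bey gax gay 0 0 /\
    partials gax gaxx gaxy 0 0 /\ smooth 0 gaxx 0 0 /\ bex 0 0 = d /\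
    gax 0 0 = a * (1 - m0 * k) /\ gay 0 0 = d * (1 - m0 * k) /\
    (a = 0 -> gaxx 0 0 = A * (1 - m0 * k) + 2 * d ^ 2 * m0).
Proof.
destruct coefficient_al_leading as (_ & alx & aly & Ha & Sax & Say).
destruct coefficient_be_leading as (_ & bex & bey & Hb & Sbx & Sby & Eb).
destruct coefficient_ga_leading as (_ & gax & gay & gaxx & gaxy & Hg & Sgx & Sgy & Egx & Egy & Hgx & Sgxx & Egxx).
exists alx, aly, bex, bey, gax, gay, gaxx, gaxy; repeat split; auto.
Qed.
End Jet.

(** * Parabolic points *)


Section CuspidalPoint.
Variables m z M : R -> R -> R.
Let al x y := II_g z x y - M x y * I_G z x y.
Let be x y := II_f z x y - M x y * I_F z x y.
Let ga x y := II_e z x y - M x y * I_E z x y.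
Variables alx aly bex bey gax gay Kx Ky : R -> R -> R.
Variables x0 y0 : R.
Hypothesis Hpart : quadratic_partials al be ga alx aly bex bey gax gay x0 y0.
Hypothesis HK : partials (gauss_K z) Kx Ky x0 y0.
Hypothesis SKx : smooth 1 Kx x0 y0.
Hypothesis SKy : smooth 1 Ky x0 y0.
Hypothesis Hg : 0 < partial_derive 0 2 z x0 y0.
Hypothesis HK0 : gauss_K z x0 y0 = 0.
Hypothesis HM0 : M x0 y0 = 0.
Hypothesis HM : locally_2d (fun x y => 0 <= gauss_K z x y -> surface_M z m x y = M x y) x0 y0.

Let p0 := - partial_derive 1 1 z x0 y0 / partial_derive 0 2 z x0 y0.

(** Joins two descriptions of the slope: the zero of F_p, which makes sense at every nearby point,
    and the null direction of the second form, which is intrinsic to parabolic points. *)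
Lemma parabolic_double_root : - be x0 y0 / al x0 y0 = p0.
Proof.
unfold al, be; rewrite HM0; unfold II_f, II_g, p0; field.
generalize (area_W_pos z x0 y0); split; lra.
Qed.

Hypothesis Hsign :
  (quadratic_x alx bex gax x0 y0 p0 + p0 * quadratic_y aly bey gay x0 y0 p0) *
  (Kx x0 y0 + p0 * Ky x0 y0) < 0.

Lemma cuspidal_at_parabolic : cuspidal_at m z M x0 y0.
Proof.
assert (Hroots := fun p => parabolic_roots z x0 y0 Hg HK0 M p HM0).
assert (Hroot : quadratic al be ga x0 y0 p0 = 0) by now apply Hroots.
assert (Hal : 0 < al x0 y0).
{ unfold al; rewrite HM0, Rmult_0_l, Rminus_0_r; apply Rdiv_lt_0_compat; auto; apply area_W_pos. }
assert (Hfold : quadratic_p al be x0 y0 p0 = 0).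
{ unfold quadratic_p; rewrite <- parabolic_double_root; field; lra. }
exists p0; split; [exact Hroots|]; split; [now apply parabolic_minimal_direction|].
split; [apply (quadratic_integral_curve_exists al be ga _ _ _ _ _ _ x0 y0 p0 Hpart)|].
intros eps gam Hgam Hgam0.
change (integral_curve (quadratic al be ga) eps gam) in Hgam.
split; [|split].
- assert (Hpos := curve_K_positive _ _ _ _ _ _ _ _ _ _ _ _ _ _ Hgam Hgam0 Hpart _ _ _ HK SKx SKy HK0 Hal Hfold Hsign).
  assert (Hder := curve_derivatives _ _ _ _ _ _ _ _ _ _ _ _ _ _ Hgam Hgam0 Hpart).
  assert (Hsurf := curve_on_surface _ _ _ _ _ _ _ _ _ _ _ _ _ _ Hgam Hgam0 Hpart Hroot).
  assert (HMc := curve_near _ _ _ _ _ _ _ _ Hgam Hgam0 _ HM).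
  assert (Hsp := curve_speed_sign _ _ _ _ _ _ _ _ _ _ _ _ _ _ Hgam Hgam0 Hpart _ _ Hal Hfold Hsign).
  (* The curve is stationary in the plane only at t = 0; elsewhere its velocity is a nonzero vector,
     as [M_direction] demands. *)
  assert (Hne : locally' 0 (fun t => quadratic_p al be (fst (fst (gam t))) (snd (fst (gam t))) (snd (gam t)) <> 0)).
  { destruct Hsp as [Hsp|Hsp]; revert Hsp; apply filter_imp; intros t Ht E; cbv beta in Ht;
    rewrite E in Ht; lra. }
  assert (Hloc := filter_and _ _ Hder (filter_and _ _ Hsurf HMc)).
  apply (filter_le_within (F := locally 0) (fun t => t <> 0)) in Hloc.
  generalize (filter_and _ _ Hpos (filter_and _ _ Hne Hloc)).
  apply filter_imp; intros t (H1 & H2 & (_ & Dx & Dy & _) & H3 & H4).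
  split; auto.
  apply M_direction_of_root with M (snd (gam t)); auto.
  (* [M] is tied to m(H, K) only where K >= 0, which [H1] supplies on the curve. *)
  + apply H4; lra.
  + now replace (Derive _ t) with (quadratic_p al be (fst (fst (gam t))) (snd (fst (gam t))) (snd (gam t)))
      by (symmetry; apply is_derive_unique, Dx).
  + rewrite (is_derive_unique _ _ _ Dx : Derive _ _ = _); apply is_derive_unique, Dy.
- exact (curve_foliations _ _ _ _ _ _ _ _ _ _ _ _ _ _ Hgam Hgam0 Hpart _ _ Hal Hroot Hfold Hsign).
- exact (curve_cusp _ _ _ _ _ _ _ _ _ _ _ _ _ _ Hgam Hgam0 Hpart _ _ Hal Hfold Hsign).
Qed.
End CuspidalPoint.

Theorem proposition4
  (m : R -> R -> R) (z : R -> R -> R) (r : nat)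
  (k a b c d A B C D E : R) (m0 m1 m2 : R) (rho : R -> R -> R)
  (Hm : mean_curvature_function m)
  (Hr : (6 <= r)%nat)
  (Hz : class_C r z)
  (Hz_jet : is_O_2d 5 (fun x y => z x y -
     (k / 2 * y ^ 2 + a / 6 * x ^ 3 + b / 2 * x * y ^ 2 + d / 2 * x ^ 2 * y
      + c / 6 * y ^ 3 + A / 24 * x ^ 4 + B / 6 * x ^ 3 * y
      + C / 4 * x ^ 2 * y ^ 2 + D / 6 * x * y ^ 3 + E / 24 * y ^ 4)))
  (Hk : 0 < k)
  (Had : a ^ 2 + d ^ 2 <> 0)
  (Hreg : one_regular_a m (k / 2) m0)
  (Hm0 : 1 / k < m0)
  (Hrho : class_C 2 rho)
  (Hrho_O : is_O_2d 2 rho)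
  (HM : locally_2d (fun x y => 0 <= gauss_K z x y ->
     surface_M z m x y = (m0 + m1 * x + m2 * y + rho x y) * gauss_K z x y) 0 0) :
  let M := fun x y => (m0 + m1 * x + m2 * y + rho x y) * gauss_K z x y in
  (a <> 0 ->
     locally_2d (fun x y => gauss_K z x y = 0 -> transversal_to_parabolic z m x y) 0 0 /\
     cuspidal_pattern_near_0 m z M) /\
  (let sigma := A * k - 3 * d ^ 2 in
   let delta := d ^ 2 * (k * m0 - 25) + 8 * A * k in
   a = 0 -> sigma <> 0 ->
     (0 < sigma -> folded_saddle (M_equation z M) 0 0) /\
     (sigma < 0 -> 0 < delta -> folded_node (M_equation z M) 0 0) /\
     (sigma < 0 -> delta < 0 -> folded_focus (M_equation z M) 0 0)).
Proof.
set (mu := fun x y => m0 + m1 * x + m2 * y + rho x y).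
intros M.
assert (Hz6 : class_C 6 z).
{ revert Hz; apply locally_2d_imp; intros x y; now apply ex_diff_n_m. }
destruct (jet4_partial_derive z k a b c d A B C D E) as ((E10 & E01) & (E20 & E11 & E02) & (E30 & E21) & E40); auto.
{ revert Hz; apply locally_2d_imp; intros x y; apply ex_diff_n_m; lia. }
assert (Smu : smooth 2 mu 0 0).
{ apply smooth_plus; [apply smooth_plus; [apply smooth_plus|]|now apply class_C_smooth];
  try apply smooth_mult; auto using smooth_const, smooth_fst, smooth_snd. }
(* The O(2) bound includes the origin itself, where its right-hand side is 0; hence rho 0 0 = 0. *)
assert (Emu : mu 0 0 = m0).
{ destruct Hrho_O as [c0 H]; apply locally_2d_singleton in H.
  replace (sqrt (0 ^ 2 + 0 ^ 2)) with 0 in H by (rewrite pow_i, Rplus_0_l, sqrt_0; auto; lia).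
  assert (Hrho0 : rho 0 0 = 0).
  { apply Rabs_eq_0, Rle_antisym; [|apply Rabs_pos]; simpl in H; lra. }
  unfold mu; rewrite Hrho0; ring. }
assert (Hmk : 1 < m0 * k).
{ apply Rmult_lt_compat_r with (r := k) in Hm0; auto.
  unfold Rdiv in Hm0; rewrite Rmult_1_l, Rinv_l in Hm0; lra. }
destruct (coefficient_partials z mu Hz6 Smu E10 E01 E20 E11) as
  (alx & aly & bex & bey & gax & gay & gaxx & gaxy & Hpart & Hgax & Sgaxx & Ebex & Egax & Egay & Egaxx).
destruct (gauss_K_leading z Hz6 E10 E01 E20 E11) as (Kx & Ky & HK & SKx & SKy & EKx).
assert (Eal := proj1 (coefficient_al_leading z mu Hz6 Smu E10 E01 E20 E11)).
assert (Ebe := proj1 (coefficient_be_leading z mu Hz6 Smu E10 E01 E20 E11)).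
assert (Ega := proj1 (coefficient_ga_leading z mu Hz6 Smu E10 E01 E20 E11)).
set (al := fun x y => II_g z x y - mu x y * gauss_K z x y * I_G z x y) in *.
set (be := fun x y => II_f z x y - mu x y * gauss_K z x y * I_F z x y) in *.
set (ga := fun x y => II_e z x y - mu x y * gauss_K z x y * I_E z x y) in *.
change (al 0 0 = partial_derive 0 2 z 0 0) in Eal. change (be 0 0 = 0) in Ebe. change (ga 0 0 = 0) in Ega.
rewrite E21 in Ebex; rewrite E30, Emu, E02 in Egax; rewrite E21, Emu, E02 in Egay;
rewrite E30, E40, E21, Emu, E02 in Egaxx; rewrite E30, E02 in EKx; rewrite E02 in Eal.
split.
- intros Ha.
  destruct (quadratic_partials_smooth _ _ _ _ _ _ _ _ _ _ _ Hpart) as (Sal & Sbe & Sga).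
  set (ps := fun x y => - be x y / al x y).
  assert (Sps : smooth 1 ps 0 0).
  { apply smooth_div; auto; [now apply smooth_opp | lra]. }
  (* F_x + p F_y, and below K_x + p K_y, at the slope [ps]: functions of the base point alone, so
     that the sign of their product at the origin spreads by continuity. *)
  set (G1 := fun x y => quadratic_x alx bex gax x y (ps x y) + ps x y * quadratic_y aly bey gay x y (ps x y)).
  set (G2 := fun x y => Kx x y + ps x y * Ky x y).
  assert (Eps : ps 0 0 = 0) by (unfold ps; rewrite Ebe, Eal; field; lra).
  assert (SG : smooth 1 (fun x y => - (G1 x y * G2 x y)) 0 0).
  { destruct Hpart as (_ & _ & _ & (S1 & S2) & (S3 & S4) & S5 & S6).
    apply smooth_opp, smooth_mult.
    - assert (Sq : forall f g h, smooth 1 f 0 0 -> smooth 1 g 0 0 -> smooth 1 h 0 0 ->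
        smooth 1 (fun x y => f x y * ps x y ^ 2 + 2 * g x y * ps x y + h x y) 0 0).
      { intros f g h Hf Hg Hh; apply smooth_plus; auto; apply smooth_plus.
        - apply smooth_mult; auto; now apply smooth_pow.
        - apply smooth_mult; auto; apply smooth_mult; auto using smooth_const. }
      apply smooth_plus; [now apply Sq | apply smooth_mult; [auto | now apply Sq]].
    - apply smooth_plus; auto; now apply smooth_mult. }
  assert (HG : locally_2d (fun x y => 0 < - (G1 x y * G2 x y)) 0 0).
  { apply (continuity_2d_pt_pos (fun x y => - (G1 x y * G2 x y))).
    - now apply (smooth_continuous 1).
    - unfold G1, G2, quadratic_x, quadratic_y; rewrite Eps, Egax, EKx.
      match goal with |- 0 < ?X => replace X with (a ^ 2 * (k * (m0 * k - 1))) by ring end.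
      apply Rmult_lt_0_compat; [now apply pow2_gt_0 | apply Rmult_lt_0_compat; lra]. }
  assert (Hal : locally_2d (fun x y => 0 < al x y) 0 0).
  { apply (continuity_2d_pt_pos al); [now apply (smooth_continuous 1) | lra]. }
  assert (Hzyy : locally_2d (fun x y => 0 < partial_derive 0 2 z x y) 0 0).
  { apply continuity_2d_pt_pos; [|lra].
    apply (smooth_continuous 1), smooth_partial_derive; auto. }
  assert (Hnear := locally_2d_and _ _ _ _ HG (locally_2d_and _ _ _ _ Hzyy (locally_2d_and _ _ _ _ HK
    (locally_2d_and _ _ _ _ (partials_open _ _ _ _ _ HK)
    (locally_2d_and _ _ _ _ (smooth_open _ _ _ _ SKx) (locally_2d_and _ _ _ _ (smooth_open _ _ _ _ SKy)
    (locally_2d_and _ _ _ _ (quadratic_partials_open _ _ _ _ _ _ _ _ _ _ _ Hpart)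
    (locally_2d_open _ _ _ HM)))))))).
  assert (HM0 : forall x y, gauss_K z x y = 0 -> M x y = 0).
  { intros x y H; unfold M; rewrite H; ring. }
  split; [|split].
  + revert Hnear; apply locally_2d_imp; intros x y (HGxy & Hg & (Dx & Dy) & _ & _ & _ & _ & HMl) HK0 u v Huv.
    assert (Hs : surface_M z m x y = 0).
    { apply locally_2d_singleton in HMl; rewrite HMl, HK0; [ring | rewrite HK0; lra]. }
    destruct (parabolic_M_direction z x y Hg HK0 m u v Hs Huv) as [Hu Hv].
    rewrite <- (parabolic_double_root z M x y Hg (HM0 _ _ HK0)) in Hv.
    change (v = ps x y * u) in Hv.
    replace (Derive (fun s => gauss_K z s y) x) with (Kx x y) by (symmetry; now apply is_derive_unique).
    replace (Derive (fun s => gauss_K z x s) y) with (Ky x y) by (symmetry; now apply is_derive_unique).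
    replace (Kx x y * u + Ky x y * v) with (G2 x y * u) by (rewrite Hv; unfold G2; ring).
    (* G1 * G2 < 0 excludes G2 = 0, the derivative of K along the M-direction up to the factor u. *)
    apply Rmult_integral_contrapositive_currified; auto; nra.
  + generalize (locally_2d_and _ _ _ _ Hnear Hal); apply locally_2d_imp.
    intros x y ((HGxy & _ & _ & _ & _ & _ & Hp & _) & Ha1) p _ HL.
    change (lie_cartan (quadratic al be ga) (x, y, p) = (0, 0, 0)) in HL.
    rewrite lie_cartan_quadratic with (1 := Hp) in HL.
    unfold quadratic_field in HL; simpl in HL; injection HL; intros H3 _ H1.
    (* A zero of the field has F_p = 0, which fixes its slope as [ps]; its last component is then -
       G1, nonzero by the sign condition. *)
    assert (Ep : p = ps x y).
    { unfold quadratic_p in H1; unfold ps; apply Rmult_eq_reg_r with (al x y); [|lra].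
      replace (- be x y / al x y * al x y) with (- be x y) by (field; lra). lra. }
    assert (G1 x y = 0) by (unfold G1; rewrite <- Ep; lra).
    nra.
  + revert Hnear; apply locally_2d_imp; intros x y (HGxy & Hg & _ & HKp & SKx' & SKy' & Hp & HMl) HK0.
    apply cuspidal_at_parabolic with alx aly bex bey gax gay Kx Ky; auto.
    rewrite <- (parabolic_double_root z M x y Hg (HM0 _ _ HK0)).
    change (G1 x y * G2 x y < 0); lra.
- intros sigma delta Ha Hsigma.
  (* With a = 0 the condition on a^2 + d^2 leaves d <> 0, whence F_y <> 0 at the singularity. *)
  assert (Hd : 0 < d ^ 2).
  { apply pow2_gt_0; intros Hd; apply Had; rewrite Ha, Hd; ring. }
  specialize (Egaxx Ha).
  assert (Egax0 : gax 0 0 = 0) by (rewrite Egax, Ha; ring).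
  assert (Hd0 : d <> 0) by (intros E0; rewrite E0 in Hd; simpl in Hd; lra).
  assert (Egay0 : gay 0 0 <> 0).
  { rewrite Egay; apply Rmult_integral_contrapositive_currified; lra. }
  assert (Eal0 : al 0 0 <> 0) by lra.
  (* The 3 d^2 in sigma: 4 k d^2 m0 - 4 d^2 = -4 d^2 (1 - m0 k) accounts for two of them, and - 2
     bex gay = -2 d^2 (1 - m0 k) for the third. *)
  assert (Edet : 2 * al 0 0 * gaxx 0 0 - 2 * bex 0 0 * (2 * bex 0 0 + gay 0 0) =
    - 2 * (m0 * k - 1) * sigma).
  { rewrite Eal, Egaxx, Ebex, Egay; unfold sigma; ring. }
  (* Taking m0 k - 1 out of d^2 (m0 k - 1)^2 + 8 (m0 k - 1) (A k - 3 d^2) leaves delta; its 25 is 1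
     + 24. *)
  assert (Edisc : (- gay 0 0) ^ 2 - 4 * (- 2 * (m0 * k - 1) * sigma) = (m0 * k - 1) * delta).
  { rewrite Egay; unfold sigma, delta; ring. }
  split; [|split].
  + intros Hs; apply (quadratic_folded_saddle al be ga alx aly bex bey gax gay gaxx gaxy); auto.
    rewrite Edet; assert (0 < (m0 * k - 1) * sigma) by (apply Rmult_lt_0_compat; lra); lra.
  + intros Hs Hdel; apply (quadratic_folded_node al be ga alx aly bex bey gax gay gaxx gaxy); auto; rewrite Edet.
    * assert (0 < (m0 * k - 1) * - sigma) by (apply Rmult_lt_0_compat; lra); lra.
    * rewrite Edisc; apply Rmult_lt_0_compat; lra.
  + intros Hs Hdel; apply (quadratic_folded_focus al be ga alx aly bex bey gax gay gaxx gaxy); auto; rewrite Edet, Edisc.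
    assert (0 < (m0 * k - 1) * - delta) by (apply Rmult_lt_0_compat; lra); lra.
Qed.
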